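(* Let $T,T'\in\mathsf{SYT}(\lambda)$, $|\lambda|=N$, with $\alpha=\mathsf{Des}(T)$ of length $\ell$ and $\beta=\mathsf{Des}(T')$, and suppose $T\xrightarrow{I}T'$ is an edge of $\mathsf{CS}(\lambda)$ with $I=[i,i+2m]=I^-\cup\{i+m\}\cup I^+$, $I^-=[i,i+m-1]$, $I^+=[i+m+1,i+2m]$, and $I^-\cup\{i+m\}\subseteq\alpha^{(j)}$. Then the sequence of blocks of $\beta$ is $(\alpha^{(1)},\dots,\alpha^{(j-2)},\ast,\alpha^{(j+2)},\dots,\alpha^{(\ell)})$ where $\ast$ is determined as follows: (1) if $T$ is rectangle-free on $[i-1,i+2m]$ and on $[i,i+2m+1]$, then the edge is length-preserving and $\ast=(\alpha^{(j-1)},\ \alpha^{(j)}\setminus\{i+m\},\ \alpha^{(j+1)}\cup\{i+m\})$; (2) if $T$ has a rectangle on $[i,i+2m+1]$, then the edge is length-increasing and $\ast=(\alpha^{(j-1)},\ \alpha^{(j)}\setminus\{i+m\},\ I^+\cup\{i+m\},\ \alpha^{(j+1)}\setminus I^+)$; (3) if $T$ has a rectangle on $[i-1,i+2m]$, then $\alpha^{(j)}=I^-\cup\{i+m\}$, the edge is length-decreasing, and $\ast=(\alpha^{(j-1)}\cup I^-,\ \alpha^{(j+1)}\cup\{i+m\})$.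
   Context: French notation; $\mathsf{SYT}(\lambda)$ standard tableaux; $\mathsf{row}(T)$ reads rows left to right from top row to bottom row; $\mathsf{std}$ replaces the $a_j$ entries $j$, in reading order, by $a_1+\dots+a_{j-1}+1,\dots,a_1+\dots+a_j$. Crystal operator $f_i$: in the subword of letters $i,i+1$, bracket each $i+1$ with an unbracketed $i$ to its right (parenthesis matching); $f_i$ changes the rightmost unbracketed $i$ to $i+1$. For a permutation $\pi$ of $[N]$ and $I=[i,i+2m]\subseteq[N]$, $m\ge1$, $I$ is a Dyck pattern interval of $\pi$ if the RSK insertion tableau of the subword $\pi|_I$ has bottom row $i,\dots,i+m$ and top row $i+m+1,\dots,i+2m$; a Dyck pattern interval of $T$ is one of $\mathsf{row}(T)$. The crystal skeleton $\mathsf{CS}(\lambda)$ is the directed graph on $\mathsf{SYT}(\lambda)$ with, for each Dyck pattern interval $I=[i,i+2m]$ of $T$, an edge $T\xrightarrow{I}\mathsf{std}(f_i(b))$, where $b$ is obtained from $T$ by replacing entries $i,\dots,i+m$ by $i$ and $i+m+1,\dots,i+2m$ by $i+1$. Descent composition: $d$ is a descent of $T$ if $d+1$ lies in a strictly higher row; for descents $d_1<\dots<d_k$, $\mathsf{Des}(T)=(d_1,d_2-d_1,\dots,N-d_k)$; a composition $\alpha=(\alpha_1,\dots,\alpha_\ell)$ is identified with its blocks $\alpha^{(j)}=\{\alpha_1+\dots+\alpha_{j-1}+1,\dots,\alpha_1+\dots+\alpha_j\}$, and blocks with index outside $[1,\ell]$ are empty and omitted. For an interval $[a,b]\subseteq[1,N]$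 of length $2m'$, $T$ has a rectangle on $[a,b]$ if the jeu de taquin rectification of the skew tableau formed by the entries of $T$ in $[a,b]$ has shape $(m',m')$; otherwise (including when $[a,b]\not\subseteq[1,N]$) $T$ is rectangle-free on $[a,b]$. *)

(* Defs.v *)
From mathcomp Require Import all_boot.
Set Implicit Arguments. Unset Strict Implicit. Unset Printing Implicit Defensive.

(* ---------- Tableaux (French notation) ----------
   A tableau is a list of rows, row 0 = bottom row (the longest);
   row r+1 lies directly above row r.  Each row is read left to right. *)
Definition tableau := seq (seq nat).

Definition is_partition (la : seq nat) : bool :=
  sorted geq la && all (fun p => 0 < p) la.

Definition shape (t : tableau) : seq nat := map size t.

(* entry in row r, column c (0-indexed); 0 if absent *)
Definition entry (t : tableau) (r c : nat) : nat := nth 0 (nth [::] t r) c.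

Definition is_SYT (la : seq nat) (t : tableau) : bool :=
  [&& is_partition la, shape t == la,
      perm_eq (flatten t) (iota 1 (sumn la)),
      all (sorted ltn) t &
      all (fun r => all (fun c => entry t r c < entry t r.+1 c)
                        (iota 0 (size (nth [::] t r.+1))))
          (iota 0 (size t))].

Definition row_word (t : tableau) : seq nat := flatten (rev t).

Definition tab_of_row (la : seq nat) (w : seq nat) : tableau :=
  rev (reshape (rev la) w).

(* ---------- standardization ----------
   the a_j occurrences of letter j (in reading order) become
   a_1+...+a_{j-1}+1, ..., a_1+...+a_j *)
Definition std_word (w : seq nat) : seq nat :=
  [seq (count (fun y => y < nth 0 w p) w
        + count (pred1 (nth 0 w p)) (take p w)).+1 | p <- iota 0 (size w)].

(* ---------- crystal operator f_i on words ----------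
   In the subword of letters i, i+1, each i+1 is bracketed with an
   unbracketed i to its right (parenthesis matching: i+1 = "(", i = ")").
   [rightmost_free_i] returns the position of the rightmost unbracketed i. *)
Fixpoint rightmost_free_i (i : nat) (w : seq nat) (pos open : nat)
  (best : option nat) : option nat :=
  match w with
  | [::] => best
  | x :: w' =>
      if x == i.+1 then rightmost_free_i i w' pos.+1 open.+1 best
      else if x == i then
        (if 0 < open then rightmost_free_i i w' pos.+1 open.-1 best
         else rightmost_free_i i w' pos.+1 0 (Some pos))
      else rightmost_free_i i w' pos.+1 open best
  end.

(* f_i w = None encodes f_i w = 0 (undefined) *)
Definition crystal_f (i : nat) (w : seq nat) : option (seq nat) :=
  match rightmost_free_i i w 0 0 None with
  | Some p => Some (set_nth 0 w p i.+1)
  | None => None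
  end.

Fixpoint ins_row (t : tableau) (x : nat) : tableau :=
  match t with
  | [::] => [:: [:: x]]
  | row :: t' =>
      let k := find (fun y => x < y) row in
      if k == size row then rcons row x :: t'
      else set_nth 0 row k x :: ins_row t' (nth 0 row k)
  end.

Definition RSK_P (w : seq nat) : tableau := foldl ins_row [::] w.

Definition dyck_interval (N : nat) (pi : seq nat) (i m : nat) : bool :=
  [&& 0 < m, 0 < i, i + 2 * m <= N &
      RSK_P [seq x <- pi | (i <= x) && (x <= i + 2 * m)]
        == [:: iota i m.+1; iota (i + m).+1 m]].

Definition dyck_collapse (i m : nat) (x : nat) : nat :=
  if (i <= x) && (x <= i + m) then i
  else if (i + m < x) && (x <= i + 2 * m) then i.+1
  else x.

Definition cs_edge (la : seq nat) (T : tableau) (i m : nat) (T' : tableau)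
  : Prop :=
  dyck_interval (sumn la) (row_word T) i m /\
  exists w', crystal_f i (map (dyck_collapse i m) (row_word T)) = Some w'
             /\ T' = tab_of_row la (std_word w').

Definition row_of (t : tableau) (v : nat) : nat := find (fun row => v \in row) t.

Definition descents (N : nat) (t : tableau) : seq nat :=
  [seq d <- iota 1 N.-1 | row_of t d < row_of t d.+1].

Definition Des (N : nat) (t : tableau) : seq nat :=
  pairmap (fun a b => b - a) 0 (rcons (descents N t) N).

(* block j (1-indexed) of a composition, as an increasing list;
   empty if j is outside [1, size alpha] *)
Definition blk (alpha : seq nat) (j : nat) : seq nat :=
  if (0 < j) && (j <= size alpha)
  then iota (sumn (take j.-1 alpha)).+1 (nth 0 alpha j.-1)
  else [::].

Definition blocks (alpha : seq nat) : seq (seq nat) :=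
  [seq blk alpha j | j <- iota 1 (size alpha)].

Definition sunion (a b : seq nat) : seq nat := sort leq (undup (a ++ b)).
Definition sminus (a b : seq nat) : seq nat := [seq x <- a | x \notin b].

(* ---------- jeu de taquin and rectangles ----------
   A skew tableau is stored as a list of rows (bottom row first) in which the
   cells of the inner shape hold 0 (all genuine entries are >= 1). *)
Fixpoint jdt_slide (fuel : nat) (t : tableau) (r c : nat) : tableau :=
  match fuel with
  | 0 => t
  | fuel'.+1 =>
      let row := nth [::] t r in
      let up := nth [::] t r.+1 in
      let hasR := c.+1 < size row in
      let hasU := c < size up in
      let xR := nth 0 row c.+1 in
      let xU := nth 0 up c in
      if hasR && (~~ hasU || (xR < xU)) then
        jdt_slide fuel' (set_nth [::] t r (set_nth 0 row c xR)) r c.+1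
      else if hasU then
        jdt_slide fuel' (set_nth [::] t r (set_nth 0 row c xU)) r.+1 c
      else [seq s <- set_nth [::] t r (take c row) | size s != 0]
  end.

(* one jeu de taquin slide into the inner corner which is the last inner
   cell of the topmost row containing inner cells *)
Definition jdt_step (t : tableau) : tableau :=
  let rs := [seq r <- iota 0 (size t) | 0 < count (pred1 0) (nth [::] t r)] in
  let r := last 0 rs in
  let c := (count (pred1 0) (nth [::] t r)).-1 in
  jdt_slide (size (flatten t)).+1 t r c.

Definition rectify (t : tableau) : tableau :=
  iter (count (pred1 0) (flatten t)) jdt_step t.

(* the skew tableau formed by the entries of T lying in [a, b]
   (entries < a form the inner shape, entries > b are removed) *)
Definition skew_restrict (T : tableau) (a b : nat) : tableau :=
  [seq s <- [seq [seq (if x < a then 0 else x) | x <- row & x <= b] | row <- T]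
   | size s != 0].

Definition has_rectangle (N : nat) (T : tableau) (a b : nat) : bool :=
  [&& 0 < a, a <= b, b <= N, odd (b - a) &
      shape (rectify (skew_restrict T a b)) == [:: (b - a).+1./2; (b - a).+1./2]].

(* Main.v *)
Require Import Defs.
From mathcomp Require Import all_boot zify.
Set Implicit Arguments. Unset Strict Implicit. Unset Printing Implicit Defensive.

(**
Write [pos v] for the position of [v] in the reading word of [T]; [d] is a
descent iff [pos (d+1) < pos d].

Row insertion never exchanges [d] and [d+1], and its first row bounds the
increasing subsequences; so on a Dyck pattern interval the letters [i..i+m]
(closing brackets) and [i+m+1..i+2m] (opening brackets) each appear in
increasing order, every opening bracket is matched, and exactly one closing
bracket [i+k] is not.  The crystal operator turns [i+k] into an opening bracket,
and after standardization the reading word of [T'] is obtained by the cyclic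
shift of the values [i+k..i+m+k] that sends [i+k] to [i+m+k].  Hence the descent
[i+m] moves to [i+m-1], and otherwise only [i-1] and [i+2m] can change status:
[i-1] stops being a descent iff [k = 0] and [pos i < pos (i-1) < pos (i+1)],
and [i+2m] becomes one iff [k = m] and [pos (i+2m) < pos (i+2m+1) < pos (i+m)].

These two configurations are the rectangles: a jeu de taquin slide preserves the
maximal lengths of increasing and of decreasing subsequences of the reading
word, so [T] has a rectangle on an interval of length [2n] iff the restricted
word has no increasing subsequence longer than [n] and no decreasing one longer
than [2].
*)

(** * Jeu de taquin and monotone chains of cells *)

(** A straight shape with 2n cells, rows of length at most n and at most two rows can only be (n,
    n); so the two extremal lengths settle whether there is a rectangle, and no finer information on
    the rectified shape has to be followed. The obstacle is the move that brings an entry down one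
    row: it carries the entry across part of the reading word, and a monotone chain through it need
    not stay a chain. Each chain therefore gets its own replacement of the same length, rerouted
    through neighbouring cells of the two rows involved. For a concrete word the bounds are refuted
    by m + 2 letters in increasing or 3 in decreasing order, and certified by a labelling with m + 1
    or 2 values that is strictly monotone along chains; here n = m + 1, because both intervals in
    question have 2m + 2 letters. The bracketing is likewise handled without running the matching:
    the injections v -> v + m + 1 left of the free letter and v -> v + m right of it, from closing
    to earlier opening brackets, show that on neither side a prefix has too many closing
    brackets. *)

Lemma some_pair_eq (a b a' b' : nat) :
  (Some (a, b) == Some (a', b')) = (a == a') && (b == b').
Proof. by rewrite (inj_eq Some_inj) xpair_eqE. Qed.

Definition rsize (t : tableau) (r : nat) : nat := size (nth [::] t r).
Definition cval (t : tableau) (p : nat * nat) : nat := entry t p.1 p.2.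

(* [h] is the hole of a running slide; its stored value is stale, which is why
   only the inequalities pointing into [h] are weakened. *)
Record skew_wf (t : tableau) (h : option (nat * nat)) : Prop := SkewWf {
  wf_size : forall r, rsize t r.+1 <= rsize t r;
  wf_row : forall r c, c.+1 < rsize t r -> entry t r c <> 0 ->
    entry t r c < entry t r c.+1 + (Some (r, c.+1) == h);
  wf_col : forall r c, c < rsize t r.+1 -> entry t r c <> 0 ->
    entry t r c < entry t r.+1 c + (Some (r.+1, c) == h)
}.

Definition live (t : tableau) (h : option (nat * nat)) (p : nat * nat) : bool :=
  [&& p.2 < rsize t p.1, Some p != h & cval t p != 0].

Definition live_inj t h : Prop :=
  forall p q, live t h p -> live t h q -> cval t p = cval t q -> p = q.

(** The reading word takes the top row first, so a larger entry in a weakly lower row comes later in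
    it; within a row, larger already means further right. [dec_rel] follows a decreasing subsequence
    from its end to its beginning. *)
Definition inc_rel (t : tableau) : rel (nat * nat) :=
  fun p q => (cval t p < cval t q) && (q.1 <= p.1).
Definition dec_rel (t : tableau) : rel (nat * nat) :=
  fun p q => (cval t p < cval t q) && (p.1 < q.1).

Definition chains_le (T : Type) (L : pred T) (e : rel T) (n : nat) : Prop :=
  forall s, all L s -> sorted e s -> size s <= n.

Lemma inc_rel_trans t : transitive (inc_rel t).
Proof. by move=> q p z /andP[a b] /andP[c d]; apply/andP; split; lia. Qed.

Lemma dec_rel_trans t : transitive (dec_rel t).
Proof. by move=> q p z /andP[a b] /andP[c d]; apply/andP; split; lia. Qed.

Lemma sorted_comparable (T : eqType) (e : rel T) (s : seq T) x :
  transitive e -> sorted e s -> x \in s ->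
  all (fun y => [|| y == x, e y x | e x y]) s.
Proof.
move=> tr so xs; rewrite sorted_pairwise // in so.
case/splitPr: xs so => s1 s2.
rewrite pairwise_cat pairwise_cons => /and3P[/allrelP h1 _ /andP[/allP h2 _]].
rewrite all_cat /= eqxx /=; apply/andP; split; apply/allP => y ys.
  by rewrite (h1 y x) ?mem_head ?orbT.
by rewrite (h2 y) ?orbT.
Qed.

(** The map [g] may depend on the chain [s], and it has to be monotone only on a set [P] containing
    [s], typically the elements comparable with one distinguished member of [s]. *)
Lemma chains_le_map (T T' : Type) (L : pred T) (L' : pred T')
    (e : rel T) (e' : rel T') n :
  (forall s, all L s -> sorted e s ->
    exists (P : pred T) (g : T -> T'), [/\ all P s, forall p, P p -> L' (g p)
      & forall p q, P p -> P q -> e p q -> e' (g p) (g q)]) ->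
  chains_le L' e' n -> chains_le L e n.
Proof.
move=> H B s Ls so; have [P [g [Ps PL Pe]]] := H s Ls so.
rewrite -(size_map g); apply: B.
  by rewrite all_map; apply: sub_all Ps => p /PL.
by apply: (homo_sorted_in (P := P)) so => // p q; apply: Pe.
Qed.

Lemma rsize_mono t h r r' : skew_wf t h -> r <= r' -> rsize t r' <= rsize t r.
Proof.
move=> wf; elim: r' => [|r' IH] hr; first by have -> : r = 0 by lia.
have [->//|] : r = r'.+1 \/ r <= r' by lia.
by move=> /IH h1; apply: leq_trans (wf_size wf r') h1.
Qed.

(** Stepping into the hole is only a weak inequality, but stepping out of it is strict; so weakness
    survives only when the hole is the last cell. *)
Lemma row_mono t h r c1 c2 : skew_wf t h -> c1 < c2 -> c2 < rsize t r ->
  entry t r c1 <> 0 ->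
  entry t r c2 <> 0 /\ entry t r c1 < entry t r c2 + (Some (r, c2) == h).
Proof.
move=> wf; elim: c2 => // c2 IH lt1 lt2 nz.
case: (ltnP c1 c2) => [lt3|le].
  have [nz2 l2] := IH lt3 (ltnW lt2) nz.
  have := wf_row wf lt2 nz2.
  case: (Some (r, c2) =P h) l2 => [<-|_]; last by case: (_ == _); lia.
  by rewrite some_pair_eq; lia.
have -> : c2 = c1 by lia.
have lt2' : c1.+1 < rsize t r by lia.
by have := wf_row wf lt2' nz; case: (_ == _); lia.
Qed.

Lemma live_row_lt t h z z' : skew_wf t h -> live t h z -> live t h z' ->
  z.1 = z'.1 -> z.2 < z'.2 -> cval t z < cval t z'.
Proof.
move=> wf /and3P[_ _ /eqP z0] /and3P[z1 /negbTE z2 z3] e l.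
have z0' : entry t z'.1 z.2 <> 0 by rewrite -e.
have [_] := row_mono wf l z1 z0'; rewrite -surjective_pairing z2 addn0.
by rewrite /cval e.
Qed.

Lemma live_row_inv t h z z' : skew_wf t h -> live t h z -> live t h z' ->
  z.1 = z'.1 -> cval t z < cval t z' -> z.2 < z'.2.
Proof.
move=> wf l l' e v; case: (ltngtP z.2 z'.2) => // [lt|e2].
  by have := ltn_trans v (live_row_lt wf l' l (esym e) lt); rewrite ltnn.
by move: v; rewrite [z]surjective_pairing e e2 -surjective_pairing ltnn.
Qed.

(** * A single move of a jeu de taquin slide *)

Definition upd (t : tableau) r c x : tableau :=
  set_nth [::] t r (set_nth 0 (nth [::] t r) c x).

Lemma rsize_row t r c : c < rsize t r -> r < size t.
Proof. by rewrite /rsize; case: (ltnP r (size t)) => // h; rewrite nth_default. Qed.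

Lemma rsize_upd t r c x r' : c < rsize t r -> rsize (upd t r c x) r' = rsize t r'.
Proof.
move=> h; rewrite /rsize /upd nth_set_nth /=; case: eqP => [->|//].
by rewrite size_set_nth; apply/maxn_idPr.
Qed.

Lemma entry_upd t r c x r' c' :
  entry (upd t r c x) r' c' = if (r', c') == (r, c) then x else entry t r' c'.
Proof.
rewrite /entry /upd nth_set_nth /= xpair_eqE; case: eqP => [->|//] /=.
by rewrite nth_set_nth /=.
Qed.

Lemma flatten_set_nth (t : tableau) r row : r < size t ->
  perm_eq (nth [::] t r ++ flatten (set_nth [::] t r row)) (row ++ flatten t).
Proof.
elim: t r => [|a t IH] [|r] //= h; apply/permP => P; first by rewrite !count_cat; lia.
by move/permP: (IH r h) => /(_ P); rewrite !count_cat; lia.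
Qed.

Lemma set_nth_perm (row : seq nat) c x : c < size row ->
  perm_eq (nth 0 row c :: set_nth 0 row c x) (x :: row).
Proof.
elim: row c => [|a row IH] [|c] //= h; apply/permP => P /=; first lia.
by move/permP: (IH c h) => /(_ P) /=; lia.
Qed.

Lemma flatten_upd t r c x : c < rsize t r ->
  perm_eq (entry t r c :: flatten (upd t r c x)) (x :: flatten t).
Proof.
move=> h; have hr := rsize_row h; apply/permP => P.
have /permP/(_ P) := flatten_set_nth (set_nth 0 (nth [::] t r) c x) hr.
have /permP/(_ P) := set_nth_perm x h.
by rewrite /= !count_cat /entry /upd; lia.
Qed.

Lemma cval_upd t r c x p :
  cval (upd t r c x) p = if p == (r, c) then x else cval t p.
Proof. by case: p => r' c'; rewrite /cval entry_upd. Qed.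

Section SlideStep.
Variables (t : tableau) (r c : nat).
Let h := Some (r, c).
Hypotheses (wf : skew_wf t h) (inj : live_inj t h).
Hypothesis cin : c < rsize t r.
Hypothesis rightnz : c.+1 < rsize t r -> entry t r c.+1 <> 0.
Hypothesis upnz : c < rsize t r.+1 -> entry t r.+1 c <> 0.

Section Right.
Hypothesis hasR : c.+1 < rsize t r.
Hypothesis xRU : c < rsize t r.+1 -> entry t r c.+1 < entry t r.+1 c.
Let t' := upd t r c (entry t r c.+1).
Let h' := Some (r, c.+1).

Lemma right_wf : skew_wf t' h'.
Proof.
have nz := rightnz hasR.
split.
- by move=> r'; rewrite !rsize_upd //; apply: wf_size wf _.
- move=> r' c'; rewrite rsize_upd // !entry_upd !xpair_eqE /h' some_pair_eq.
  case: (r' =P r) => [->|ne] /= l1; last first.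
    by move=> nz'; have := wf_row wf l1 nz'; rewrite /h some_pair_eq; lia.
  case: (c' =P c) => [->|ne2]; first by case: eqP; lia.
  case: (c'.+1 =P c) => [e2|ne3] nz'.
    have c12 : c' < c.+1 by lia.
    by have [_] := row_mono wf c12 hasR nz'; rewrite /h some_pair_eq; lia.
  by have := wf_row wf l1 nz'; rewrite /h some_pair_eq; lia.
- move=> r' c'; rewrite rsize_upd // !entry_upd !xpair_eqE /h' some_pair_eq.
  case: (c' =P c) => [->|ne] l1; last first.
    by rewrite !andbF => nz'; have := wf_col wf l1 nz'; rewrite /h some_pair_eq; lia.
  rewrite !andbT; case: (r' =P r) l1 => [->|ne] l1 /=.
    by case: (r.+1 =P r); [lia | move=> _ _; have := xRU l1; lia].
  case: (r'.+1 =P r) => [e|ne2] nz'.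
    have l2 : c.+1 < rsize t r'.+1 by rewrite e.
    have lr : rsize t r'.+1 <= rsize t r' := wf_size wf r'.
    have c12 : c < c.+1 by lia.
    have l3 : c.+1 < rsize t r' by lia.
    have [nz2] := row_mono wf c12 l3 nz'.
    by have := wf_col wf l2 nz2; rewrite /h !some_pair_eq e; lia.
  by have := wf_col wf l1 nz'; rewrite /h some_pair_eq; lia.
Qed.

Definition right_fwd (p : nat * nat) := if p == (r, c.+1) then (r, c) else p.
Definition right_bwd (p : nat * nat) := if p == (r, c) then (r, c.+1) else p.

Lemma right_fwd_live p : live t h p -> live t' h' (right_fwd p) /\ cval t' (right_fwd p) = cval t p.
Proof.
case: p => r' c'; rewrite /live /right_fwd rsize_upd // !cval_upd /h /h' !xpair_eqE some_pair_eq.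
case: (r' =P r) => [->|ne]; case: (c' =P c.+1) => [->|ne2] /=;
  rewrite ?some_pair_eq ?xpair_eqE ?eqxx /cval /=; try (case: (c' =P c) => [->|?] //=);
  do ?case: ifP => ?; lia.
Qed.

Lemma right_bwd_live p : live t' h' p -> live t h (right_bwd p) /\ cval t' p = cval t (right_bwd p).
Proof.
case: p => r' c'; rewrite /live /right_bwd rsize_upd // !cval_upd /h /h' !xpair_eqE some_pair_eq.
case: (r' =P r) => [->|ne]; case: (c' =P c) => [->|ne2] /=;
  rewrite ?some_pair_eq ?xpair_eqE ?eqxx /cval /=; lia.
Qed.

Lemma right_inj : live_inj t' h'.
Proof.
move=> p q lp lq e.
have [lp' ep] := right_bwd_live lp; have [lq' eq] := right_bwd_live lq.
have := inj lp' lq'; rewrite -ep -eq e => /(_ erefl).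
rewrite /right_bwd; move: lp lq => /and3P[_ np _] /and3P[_ nq _].
case: eqP => [->|n1]; case: eqP => [->|n2] // e2.
  by case/eqP: nq; rewrite -e2.
by case/eqP: np; rewrite e2.
Qed.

Lemma right_row (p : nat * nat) : (right_fwd p).1 = p.1 /\ (right_bwd p).1 = p.1.
Proof. by rewrite /right_fwd /right_bwd; split; case: eqP => [->|]. Qed.

(** An entry that slides left stays in its row, and the chain relations see only values and rows, so
    renaming one cell is enough. The parameter [e] covers increasing and decreasing chains at
    once. *)
Lemma right_chains (e : rel nat) n :
  let R u := fun p q => (cval u p < cval u q) && e p.1 q.1 in
  chains_le (live t h) (R t) n <-> chains_le (live t' h') (R t') n.
Proof.
move=> R; split; apply: chains_le_map => s Ls _.
  exists (live t' h'), right_bwd; split=> // [p /right_bwd_live[]//|p q].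
  move=> /right_bwd_live[_ e1] /right_bwd_live[_ e2].
  by rewrite /R -e1 -e2 !(right_row _).2.
exists (live t h), right_fwd; split=> // [p /right_fwd_live[]//|p q].
move=> /right_fwd_live[_ e1] /right_fwd_live[_ e2].
by rewrite /R e1 e2 !(right_row _).1.
Qed.
End Right.

Section Up.
Hypothesis hasU : c < rsize t r.+1.
Hypothesis xUR : c.+1 < rsize t r -> entry t r.+1 c <= entry t r c.+1.
Let x := entry t r.+1 c.
Let t' := upd t r c x.
Let h' := Some (r.+1, c).

(** Failure of the test [xR < xU] gives only a weak inequality; equality is excluded because live
    entries are distinct. *)
Lemma up_strict : c.+1 < rsize t r -> x < entry t r c.+1.
Proof.
move=> l; rewrite ltn_neqAle xUR // andbT; apply/eqP => e.
have l1 : live t h (r.+1, c).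
  by rewrite /live hasU /h some_pair_eq; apply/and3P; split => //; [lia | apply/eqP/upnz].
have l2 : live t h (r, c.+1).
  by rewrite /live l /h some_pair_eq; apply/and3P; split => //; [lia | apply/eqP/rightnz].
by have [] := inj l1 l2 e; lia.
Qed.

Lemma up_wf : skew_wf t' h'.
Proof.
have nz := upnz hasU.
split.
- by move=> r'; rewrite !rsize_upd //; apply: wf_size wf _.
- move=> r' c'; rewrite rsize_upd // !entry_upd !xpair_eqE /h' some_pair_eq.
  case: (r' =P r) => [->|ne] /= l1; last first.
    by move=> nz'; have := wf_row wf l1 nz'; rewrite /h some_pair_eq; lia.
  case: (c' =P c) l1 => [->|ne2] l1; first by have := up_strict l1; case: eqP; lia.
  case: (c'.+1 =P c) => [e2|ne3] nz'.
    have l2 : c' < rsize t r.+1 by lia.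
    have := wf_col wf l2 nz'; rewrite /h some_pair_eq => l3.
    have nz2 : entry t r.+1 c' <> 0 by lia.
    have c12 : c' < c by lia.
    by have [_] := row_mono wf c12 hasU nz2; rewrite /h some_pair_eq -/x; lia.
  by have := wf_row wf l1 nz'; rewrite /h some_pair_eq; lia.
- move=> r' c'; rewrite rsize_upd // !entry_upd !xpair_eqE /h' some_pair_eq.
  case: (c' =P c) => [->|ne] l1; last first.
    by rewrite !andbF => nz'; have := wf_col wf l1 nz'; rewrite /h some_pair_eq; lia.
  rewrite !andbT; case: (r' =P r) l1 => [->|ne] l1 /=.
    by case: (r.+1 =P r); rewrite -/x; lia.
  case: (r'.+1 =P r) => [e|ne2] nz'.
    have l2 : c < rsize t r'.+1 by rewrite e.
    have := wf_col wf l2 nz'; rewrite /h some_pair_eq e => l3.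
    have nz2 : entry t r c <> 0 by lia.
    by have := wf_col wf hasU nz2; rewrite /h some_pair_eq -/x; lia.
  by have := wf_col wf l1 nz'; rewrite /h some_pair_eq; lia.
Qed.

Lemma up_cval p : p <> (r, c) -> cval t' p = cval t p.
Proof. by move=> /eqP/negbTE ne; rewrite cval_upd ne. Qed.

Lemma up_cval_hole : cval t' (r, c) = x.
Proof. by rewrite cval_upd eqxx. Qed.

Lemma up_live_hole : live t' h' (r, c).
Proof.
rewrite /live rsize_upd // cin up_cval_hole /h' some_pair_eq.
by have := upnz hasU; rewrite /x; lia.
Qed.

Lemma up_live_x : live t h (r.+1, c).
Proof. by have := upnz hasU; rewrite /live /h some_pair_eq /cval /=; lia. Qed.

Lemma up_live_same p : p <> (r, c) -> p <> (r.+1, c) -> live t' h' p = live t h p.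
Proof.
move=> n1 n2; rewrite /live rsize_upd // up_cval // /h /h' !(inj_eq Some_inj).
by move/eqP/negbTE: n1 => ->; move/eqP/negbTE: n2 => ->.
Qed.

Lemma live_neq_hole p : live t h p -> p <> (r, c).
Proof. by case/and3P=> _ /eqP ne _ e; apply: ne; rewrite e. Qed.

Lemma live_neq_hole' p : live t' h' p -> p <> (r.+1, c).
Proof. by case/and3P=> _ /eqP ne _ e; apply: ne; rewrite e. Qed.

Lemma up_inj : live_inj t' h'.
Proof.
have key p : live t' h' p -> p <> (r, c) -> live t h p /\ cval t' p = cval t p.
  by move=> l n; rewrite up_cval // -up_live_same //; apply: live_neq_hole'.
move=> p q lp lq.
case: (p =P (r, c)) => [->|n1]; case: (q =P (r, c)) => [->//|n2].
- have [lq' ->] := key _ lq n2; rewrite up_cval_hole => e.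
  by case: (live_neq_hole' lq); apply/esym/inj => //; apply: up_live_x.
- have [lp' ->] := key _ lp n1; rewrite up_cval_hole => e.
  by case: (live_neq_hole' lp); apply/inj => //; apply: up_live_x.
have [lq' ->] := key _ lq n2; have [lp' ->] := key _ lp n1; exact: inj.
Qed.

(* The cells weakly right of [x] in its row are pushed down one row. *)
Lemma up_inc_fwd n : chains_le (live t' h') (inc_rel t') n ->
  chains_le (live t h) (inc_rel t) n.
Proof.
apply: chains_le_map => s Ls so.
case: (boolP ((r.+1, c) \in s)) => [xs|xs]; last first.
  exists [pred p | live t h p && (p != (r.+1, c))], id.
  have neq p : live t h p && (p != (r.+1, c)) -> p <> (r, c) /\ p <> (r.+1, c).
    by move=> /andP[/live_neq_hole ? /eqP ?].
  split.
  - apply/allP => p ps; rewrite /= (allP Ls) //.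
    by apply: contraNneq xs => <-.
  - by move=> p /= lp; have [n1 n2] := neq _ lp; rewrite up_live_same //; case/andP: lp.
  - by move=> p q /= /neq[n1 n2] /neq[n3 n4]; rewrite /inc_rel !up_cval.
(* Once [x] lies in row [r], the chain can no longer continue in row [r.+1]. The entries below its
   continuation exceed [x] by [up_strict], increase along row [r], and are smaller than the entries
   they replace, so the later members still fit. *)
pose g (p : nat * nat) := if (p.1 == r.+1) && (c <= p.2) then (r, p.2) else p.
(* Monotonicity of [g] from an unmoved to a moved cell rests on comparability with [x], which all
   members of a chain through [x] have. *)
pose P p := live t h p && [|| p == (r.+1, c), inc_rel t p (r.+1, c) | inc_rel t (r.+1, c) p].
have gE p : P p -> [/\ live t' h' (g p), cval t' (g p) <= cval t p,
    (p.1 != r.+1) || (p.2 < c) -> g p = p /\ cval t' p = cval t p &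
    (p.1 == r.+1) && (c < p.2) -> x < cval t' (g p)].
  move=> /andP[lp cp]; have nh := live_neq_hole lp.
  case: (p =P (r.+1, c)) => [->|nx].
    have -> : g (r.+1, c) = (r, c) by rewrite /g /= eqxx leqnn.
    by rewrite up_live_hole up_cval_hole /=; split=> //; lia.
  case: (boolP ((p.1 == r.+1) && (c < p.2))) => [/andP[/eqP e1 l2]|no].
    have -> : g p = (r, p.2) by rewrite /g e1 eqxx (ltnW l2).
    have nrc : (r, p.2) <> (r, c) by case; clear -l2; lia.
    have nrc' : (r, p.2) <> (r.+1, c) by case; clear; lia.
    case/and3P: (lp) => lp1 lp2 lp3.
    have ps1 : p.2 < rsize t r.+1 by rewrite -e1.
    have ps0 : p.2 < rsize t r by apply: leq_trans (wf_size wf r).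
    have cs : c.+1 < rsize t r by clear -l2 ps0; lia.
    have xr := up_strict cs.
    have [nz ltx] : entry t r p.2 <> 0 /\ x < entry t r p.2.
      have [e2|c12] : p.2 = c.+1 \/ c.+1 < p.2 by clear -l2; lia.
        by rewrite e2; split=> //; clear -xr; lia.
      by have [] := row_mono wf c12 ps0 (rightnz cs); rewrite /h some_pair_eq; clear -xr c12; lia.
    rewrite up_cval // up_live_same // /live /= ps0 /h some_pair_eq /cval /= e1.
    have := wf_col wf ps1 nz; rewrite /h some_pair_eq => lc.
    by clear -l2 lc nz ltx; split; lia.
  have gp : g p = p.
    rewrite /g; case: ifP => // /andP[/eqP e1 e2].
    by case: nx; rewrite [p]surjective_pairing e1; congr pair; clear -no e1 e2; lia.
  by rewrite gp up_live_same // up_cval //; split=> // b; rewrite b in no.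
exists P, g; split.
- by apply/allP => p ps; rewrite /P (allP Ls) //= (allP (sorted_comparable (@inc_rel_trans t) so xs)).
- by move=> p /gE[].
move=> p q Pp Pq pq; have [lp gp1 gp2 gp3] := gE _ Pp; have [lq gq1 gq2 gq3] := gE _ Pq.
case/andP: (pq) => vpq rpq.
have [lpt cp] := andP Pp; have [lqt cq] := andP Pq.
have xlive := up_live_x.
case: (boolP ((q.1 == r.+1) && (c <= q.2))) => [sq|nsq]; last first.
  have nsq' : (q.1 != r.+1) || (q.2 < c) by clear -nsq; lia.
  have [gq eq] := gq2 nsq'; rewrite /inc_rel gq eq.
  case: (boolP ((p.1 == r.+1) && (c <= p.2))) => [sp|nsp]; last first.
    have nsp' : (p.1 != r.+1) || (p.2 < c) by clear -nsp; lia.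
    by have [-> ->] := gp2 nsp'; rewrite vpq.
  have -> : (g p).1 = r by rewrite /g sp.
  rewrite (leq_ltn_trans gp1 vpq) /=.
  case: (q.1 =P r.+1) => [e1|ne1]; last by clear -ne1 sp rpq; lia.
  have e : p.1 = q.1 by clear -e1 sp; lia.
  have := live_row_inv wf lpt lqt e vpq; clear -e1 sp nsq; lia.
have gqE : g q = (r, q.2) by rewrite /g sq.
have xq : x <= cval t' (g q).
  case: (q.2 =P c) => [e2|ne2]; first by rewrite gqE e2 up_cval_hole.
  by apply/ltnW/gq3; clear -ne2 sq; lia.
case: (boolP ((p.1 == r.+1) && (c <= p.2))) => [sp|nsp]; last first.
  have nsp' : (p.1 != r.+1) || (p.2 < c) by clear -nsp; lia.
  have [-> ep] := gp2 nsp'; rewrite /inc_rel ep gqE /=.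
  rewrite gqE in xq; rewrite andbC; apply/andP; split; first by clear -sq rpq; lia.
  case/or3P: cp => [/eqP e|/andP[l _]|/andP[l1 l2]].
  - by move: nsp; rewrite e /= eqxx leqnn.
  - by apply: leq_trans l _.
  - rewrite /= in l2.
    have e : p.1 = r.+1 by clear -l2 rpq sq; lia.
    have := live_row_inv wf xlive lpt (esym e) l1; clear -nsp e => /=; lia.
have gpE : g p = (r, p.2) by rewrite /g sp.
have pq1 : p.1 = q.1 by clear -sp sq; lia.
have pq2 : p.2 < q.2 := live_row_inv wf lpt lqt pq1 vpq.
rewrite /inc_rel gqE gpE /= leqnn andbT.
have q1 : x < cval t' (g q) by apply: gq3; clear -sq sp pq2; lia.
case: (p.2 =P c) => [e2|ne2]; first by rewrite e2 up_cval_hole -gqE.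
have np : (r, p.2) <> (r, c) by case.
have nq : (r, q.2) <> (r, c) by case=> e; move: sp pq2 ne2; clear -e; lia.
rewrite !up_cval //.
have qs : q.2 < rsize t r.
  by apply: leq_trans (wf_size wf r); case/and3P: lqt; case/andP: sq => /eqP->.
have nz : entry t r p.2 <> 0.
  by case/and3P: lp => _ _; rewrite gpE up_cval // /cval => /eqP.
have [_] := row_mono wf pq2 qs nz; rewrite /h some_pair_eq /cval.
by have -> : q.2 == c = false; [apply/eqP => e; apply: nq; rewrite e | rewrite andbF addn0].
Qed.

(* The cells left of the hole in its row are pushed up one row. *)
Lemma up_inc_bwd n : chains_le (live t h) (inc_rel t) n ->
  chains_le (live t' h') (inc_rel t') n.
Proof.
apply: chains_le_map => s Ls so.
have same p : live t' h' p -> p <> (r, c) -> live t h p /\ cval t' p = cval t p.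
  by move=> l ne; rewrite -up_live_same ?up_cval //; apply: live_neq_hole'.
case: (boolP ((r, c) \in s)) => [xs|xs]; last first.
  exists [pred p | live t' h' p && (p != (r, c))], id; split.
  - by apply/allP => p ps; rewrite /= (allP Ls) //; apply: contraNneq xs => <-.
  - by move=> p /= /andP[l /eqP ne]; have [] := same _ l ne.
  - move=> p q /= /andP[l /eqP ne] /andP[l' /eqP ne'].
    by have [_ e1] := same _ l ne; have [_ e2] := same _ l' ne'; rewrite /inc_rel e1 e2.
(* Before the move [x] lies in row [r.+1], so its predecessors in row [r] are too low. The entries
   above them are larger, hence still follow the earlier members, and stay below [x] because row
   [r.+1] increases. *)
pose g (p : nat * nat) := if (p.1 == r) && (p.2 <= c) then (r.+1, p.2) else p.
pose P p := live t' h' p && [|| p == (r, c), inc_rel t' p (r, c) | inc_rel t' (r, c) p].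
have gl p : P p -> (p.1 == r) && (p.2 <= c) ->
    [/\ live t h (g p), g p = (r.+1, p.2) & p <> (r, c) ->
      cval t' p < entry t r.+1 p.2 /\ entry t r.+1 p.2 < x].
  move=> /andP[lp cp] sp; rewrite /g sp; case/andP: sp => /eqP e1 l2.
  case: (p.2 =P c) => [e2|ne2].
    by rewrite e2; split=> //; [exact: up_live_x | case; rewrite [p]surjective_pairing e1 e2].
  have nh : p <> (r, c) by move=> e; apply: ne2; rewrite e.
  have [lp' ->] := same _ lp nh.
  have l3 : p.2 < rsize t r.+1 by clear -l2 hasU; lia.
  have nz : entry t r p.2 <> 0 by case/and3P: lp' => _ _ /eqP; rewrite /cval e1.
  have := wf_col wf l3 nz; rewrite /h some_pair_eq => l4.
  have nz1 : entry t r.+1 p.2 <> 0 by clear -l4; lia.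
  have l2' : p.2 < c by clear -l2 ne2; lia.
  have [_] := row_mono wf l2' hasU nz1; rewrite /h some_pair_eq -/x => l5.
  by rewrite /live /cval /= e1 some_pair_eq; split=> //; clear -l3 l4 l5 nz1; lia.
have gn p : P p -> ~~ ((p.1 == r) && (p.2 <= c)) -> [/\ g p = p, live t h p & cval t' p = cval t p].
  move=> /andP[lp _] np; rewrite /g (negbTE np).
  have ne : p <> (r, c) by move=> e; move: np; rewrite e /= eqxx leqnn.
  by have [] := same _ lp ne.
exists P, g; split.
- by apply/allP => p ps; rewrite /P (allP Ls) //= (allP (sorted_comparable (@inc_rel_trans t') so xs)).
- move=> p Pp; case: (boolP ((p.1 == r) && (p.2 <= c))) => sp; first by have [] := gl _ Pp sp.
  by have [-> ] := gn _ Pp sp.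
have wf' := up_wf.
move=> p q Pp Pq /andP[vpq rpq]; have [lpt cp] := andP Pp; have [lqt cq] := andP Pq.
have hl := up_live_hole.
case: (boolP ((q.1 == r) && (q.2 <= c))) => [sq|nsq].
  have [lq gq gq'] := gl _ Pq sq.
  have qv : cval t' q <= cval t (g q).
    rewrite gq; case: (q =P (r, c)) => [->|/gq' [+ _]]; last exact: ltnW.
    by rewrite up_cval_hole.
  case: (boolP ((p.1 == r) && (p.2 <= c))) => [sp|nsp]; last first.
    have [gp lp ep] := gn _ Pp nsp; rewrite /inc_rel gp -ep (leq_trans vpq qv) gq /=.
    case: (p.1 =P r) => e; last by clear -e rpq sq; lia.
    have e' : p.1 = q.1 by clear -e sq; lia.
    have := live_row_inv wf' lpt lqt e' vpq; clear -e nsp sq; lia.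
  have [lp gp gp'] := gl _ Pp sp.
  have pq1 : p.1 = q.1 by clear -sp sq; lia.
  have pq2 : p.2 < q.2 := live_row_inv wf' lpt lqt pq1 vpq.
  rewrite /inc_rel gp gq /= leqnn andbT.
  have pn : p <> (r, c) by move=> e; move: pq2 sq; clear -e; rewrite e /=; lia.
  have [v1 _] := gp' pn.
  have qs : q.2 < rsize t r.+1 by clear -sq hasU; lia.
  have nz : entry t r.+1 p.2 <> 0 by clear -v1; lia.
  have [_] := row_mono wf pq2 qs nz; rewrite /h some_pair_eq /cval.
  by have -> : r.+1 == r = false; [clear; lia | rewrite addn0].
have [gq lq eq] := gn _ Pq nsq; rewrite /inc_rel gq -eq.
case: (boolP ((p.1 == r) && (p.2 <= c))) => [sp|nsp]; last first.
  by have [-> _ <-] := gn _ Pp nsp; rewrite vpq.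
have [lp gp gp'] := gl _ Pp sp; rewrite gp /=; apply/andP; split; last by clear -sp rpq; lia.
case: (p =P (r, c)) => [e|/gp' [_ v2]].
  by move: vpq; rewrite e up_cval_hole.
apply: ltn_trans v2 _.
case/or3P: cq => [/eqP e|/andP[l l1]|/andP[l1 l2]].
- by move: nsq; rewrite e /= eqxx leqnn.
- rewrite /= in l1; have e : q.1 = r by clear -l1 rpq sp; lia.
  by have := live_row_inv wf' lqt hl e l; move: nsq; clear -e => /=; lia.
- by rewrite up_cval_hole in l1.
Qed.

(** The critical chains contain [x] and also a cell [(r, c0)], since [x] drops into that row. Then
    [c0 < c], and the entry above [(r, c0)] lies strictly between the two in value and can stand in
    for [x]. Without a cell in row [r], the new cell of [x] serves. *)
Lemma up_dec_fwd n : chains_le (live t' h') (dec_rel t') n ->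
  chains_le (live t h) (dec_rel t) n.
Proof.
apply: chains_le_map => s Ls so.
have same p : live t h p -> p <> (r.+1, c) -> live t' h' p /\ cval t' p = cval t p.
  by move=> l ne; have nh := live_neq_hole l; rewrite up_live_same ?up_cval.
have cmp y := sorted_comparable (x := y) (@dec_rel_trans t) so.
case: (boolP ((r.+1, c) \in s)) => [xs|xs]; last first.
  exists [pred p | live t h p && (p != (r.+1, c))], id; split.
  - by apply/allP => p ps; rewrite /= (allP Ls) //; apply: contraNneq xs => <-.
  - by move=> p /= /andP[l /eqP ne]; have [] := same _ l ne.
  - move=> p q /= /andP[l /eqP ne] /andP[l' /eqP ne'].
    by have [_ e1] := same _ l ne; have [_ e2] := same _ l' ne'; rewrite /dec_rel e1 e2.
case: (boolP (has (fun p => p.1 == r) s)) => [/hasP[[r0 c0] p0s /eqP /= p0r]|/hasPn nor].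
  subst r0; pose p0 := (r, c0); pose y := (r.+1, c0).
  have lp0 : live t h p0 := allP Ls _ p0s.
  have p0x : entry t r c0 < x.
    case/or3P: (allP (cmp _ xs) _ p0s) => [/eqP[e _]|/andP[]//|/andP[_] /=].
      by clear -e; lia.
    by clear; lia.
  have p0c : c0 < c.
    have nh := live_neq_hole lp0.
    case: (ltngtP c0 c) => // [l|e]; last by case: nh; rewrite /p0 e.
    have p0s' : c0 < rsize t r by case/and3P: lp0.
    have cs : c.+1 < rsize t r by clear -l p0s'; lia.
    have xr := up_strict cs.
    have [e|c12] : c0 = c.+1 \/ c.+1 < c0 by clear -l; lia.
      by move: p0x; rewrite e; clear -xr; lia.
    have [_] := row_mono wf c12 p0s' (rightnz cs); rewrite /h some_pair_eq.
    by clear -xr p0x c12; lia.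
  have l3 : c0 < rsize t r.+1 by clear -p0c hasU; lia.
  have nz : entry t r c0 <> 0 by case/and3P: lp0 => _ _ /eqP.
  have := wf_col wf l3 nz; rewrite /h some_pair_eq => l4.
  have nz1 : entry t r.+1 c0 <> 0 by clear -l4; lia.
  have [_] := row_mono wf p0c hasU nz1; rewrite /h some_pair_eq -/x => l5.
  have ly : live t h y by rewrite /y /live /cval /= /h some_pair_eq; clear -nz1 l3; lia.
  have yx : y <> (r.+1, c) by case; clear -p0c; lia.
  have [ly' ey] := same _ ly yx.
  have vy : cval t p0 < cval t y < x by rewrite /cval /=; clear -l4 l5; lia.
  pose g p := if p == (r.+1, c) then y else p.
  exists [pred p | [&& live t h p, [|| p == p0, dec_rel t p p0 | dec_rel t p0 p]
     & [|| p == (r.+1, c), dec_rel t p (r.+1, c) | dec_rel t (r.+1, c) p]]], g; split.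
  - by apply/allP => p ps; rewrite /= (allP Ls) // (allP (cmp _ p0s)) // (allP (cmp _ xs)).
  - move=> p /= /and3P[lp _ _]; rewrite /g; case: eqP => // ne.
    by have [] := same _ lp ne.
  - move=> p q /= /and3P[lp cp _] /and3P[lq cq _] /andP[v1 v2].
    rewrite /g; case: (p =P (r.+1, c)) v1 v2 => [-> {lp cp p}|n1];
      case: (q =P (r.+1, c)) => [-> {lq cq q}|n2] v1 v2; rewrite /dec_rel.
    + by move: v2; rewrite ltnn.
    + have [_ ->] := same _ lq n2; rewrite ey; apply/andP; split=> //.
      by apply: ltn_trans v1; case/andP: vy.
    + have [_ ->] := same _ lp n1; rewrite ey; apply/andP; split=> //.
      rewrite /= in v2; case/andP: vy => vy _.
      case/or3P: cp => [/eqP->//|/andP[l _]|/andP[_ l]]; first exact: ltn_trans l vy.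
      by move: l; rewrite /p0 /=; clear -v2; lia.
    + by have [_ ->] := same _ lp n1; have [_ ->] := same _ lq n2; rewrite v1.
pose g p := if p == (r.+1, c) then (r, c) else p.
exists [pred p | live t h p && (p.1 != r)], g; split.
- by apply/allP => p ps; rewrite /= (allP Ls) //= nor.
- move=> p /= /andP[lp _]; rewrite /g; case: eqP => // ne; first exact: up_live_hole.
  by have [] := same _ lp ne.
- move=> p q /= /andP[lp cp] /andP[lq cq] /andP[v1 v2].
  rewrite /g; case: (p =P (r.+1, c)) v1 v2 => [-> {lp cp p}|n1];
    case: (q =P (r.+1, c)) => [-> {lq cq q}|n2] /= v1 v2; rewrite /dec_rel.
  + by move: v2; rewrite ltnn.
  + by have [_ ->] := same _ lq n2; rewrite up_cval_hole v1 /=; clear -v2; lia.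
  + by have [_ ->] := same _ lp n1; rewrite up_cval_hole v1 /=; clear -v2 cp; lia.
  + by have [_ ->] := same _ lp n1; have [_ ->] := same _ lq n2; rewrite v1.
Qed.

(** The mirror image: a chain with [x] in row [r] conflicts with the old place of [x] only if it
    contains some [(r.+1, c0)]. Then [c < c0], and the entry below that cell lies between [x] and
    it. *)
Lemma up_dec_bwd n : chains_le (live t h) (dec_rel t) n ->
  chains_le (live t' h') (dec_rel t') n.
Proof.
apply: chains_le_map => s Ls so.
have same p : live t' h' p -> p <> (r, c) -> live t h p /\ cval t' p = cval t p.
  by move=> l ne; rewrite -up_live_same ?up_cval //; apply: live_neq_hole'.
have cmp y := sorted_comparable (x := y) (@dec_rel_trans t') so.
case: (boolP ((r, c) \in s)) => [xs|xs]; last first.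
  exists [pred p | live t' h' p && (p != (r, c))], id; split.
  - by apply/allP => p ps; rewrite /= (allP Ls) //; apply: contraNneq xs => <-.
  - by move=> p /= /andP[l /eqP ne]; have [] := same _ l ne.
  - move=> p q /= /andP[l /eqP ne] /andP[l' /eqP ne'].
    by have [_ e1] := same _ l ne; have [_ e2] := same _ l' ne'; rewrite /dec_rel e1 e2.
case: (boolP (has (fun p => p.1 == r.+1) s)) => [/hasP[[r0 c0] p0s /eqP /= p0r]|/hasPn nor].
  subst r0; pose p0 := (r.+1, c0); pose y := (r, c0).
  have lp0' : live t' h' p0 := allP Ls _ p0s.
  have n0 : p0 <> (r, c) by case; clear; lia.
  have [lp0 e0] := same _ lp0' n0.
  have p0x : x < cval t p0.
    case/or3P: (allP (cmp _ xs) _ p0s) => [/eqP//|/andP[_] /=|/andP[+ _]].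
      by clear; lia.
    by rewrite up_cval_hole -/p0 e0.
  have p0s1 : c0 < rsize t r.+1 by case/and3P: lp0.
  have p0c : c < c0.
    have nh := live_neq_hole' lp0'.
    case: (ltngtP c0 c) => // [l|e]; last by case: nh; rewrite /p0 e.
    have nz : entry t r.+1 c0 <> 0 by case/and3P: lp0 => _ _ /eqP.
    have [_] := row_mono wf l hasU nz; rewrite /h some_pair_eq -/x.
    by move: p0x; rewrite /cval /p0 /=; clear; lia.
  have p0s0 : c0 < rsize t r by apply: leq_trans (wf_size wf r).
  have cs : c.+1 < rsize t r by clear -p0c p0s0; lia.
  have xr := up_strict cs.
  have [nz ltx] : entry t r c0 <> 0 /\ x < entry t r c0.
    have [->|c12] : c0 = c.+1 \/ c.+1 < c0 by clear -p0c; lia.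
      by split=> //; clear -xr; lia.
    by have [] := row_mono wf c12 p0s0 (rightnz cs); rewrite /h some_pair_eq; clear -xr c12; lia.
  have := wf_col wf p0s1 nz; rewrite /h some_pair_eq => l4.
  have ly : live t h y by rewrite /y /live /cval /= /h some_pair_eq; clear -nz p0s0 p0c; lia.
  have vy : x < cval t y < cval t p0 by rewrite /cval /=; clear -l4 ltx; lia.
  pose g p := if p == (r, c) then y else p.
  exists [pred p | [&& live t' h' p, [|| p == p0, dec_rel t' p p0 | dec_rel t' p0 p]
     & [|| p == (r, c), dec_rel t' p (r, c) | dec_rel t' (r, c) p]]], g; split.
  - by apply/allP => p ps; rewrite /= (allP Ls) // (allP (cmp _ p0s)) // (allP (cmp _ xs)).
  - move=> p /= /and3P[lp _ _]; rewrite /g; case: eqP => // ne.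
    by have [] := same _ lp ne.
  - move=> p q /= /and3P[lp cp _] /and3P[lq cq _] /andP[v1 v2].
    rewrite /g; case: (p =P (r, c)) v1 v2 => [-> {lp cp p}|n1];
      case: (q =P (r, c)) => [-> {lq cq q}|n2] v1 v2; rewrite /dec_rel.
    + by move: v2; rewrite ltnn.
    + have [_ eq] := same _ lq n2; apply/andP; split=> //.
      rewrite /= in v2; rewrite /dec_rel e0 eq in cq.
      case/andP: vy => _ vy.
      case/or3P: cq => [/eqP->//|/andP[_ l]|/andP[l _]]; last exact: ltn_trans vy l.
      by move: l; rewrite /p0 /=; clear -v2; lia.
    + have [_ ep] := same _ lp n1; apply/andP; split=> //.
      by rewrite -ep; apply: ltn_trans v1 _; rewrite up_cval_hole; case/andP: vy.
    + by have [_ <-] := same _ lp n1; have [_ <-] := same _ lq n2; rewrite v1.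
pose g p := if p == (r, c) then (r.+1, c) else p.
exists [pred p | live t' h' p && (p.1 != r.+1)], g; split.
- by apply/allP => p ps; rewrite /= (allP Ls) //= nor.
- move=> p /= /andP[lp _]; rewrite /g; case: eqP => // ne; first exact: up_live_x.
  by have [] := same _ lp ne.
- move=> p q /= /andP[lp cp] /andP[lq cq] /andP[v1 v2].
  rewrite /g; case: (p =P (r, c)) v1 v2 => [-> {lp cp p}|n1];
    case: (q =P (r, c)) => [-> {lq cq q}|n2] /= v1 v2; rewrite /dec_rel.
  + by move: v2; rewrite ltnn.
  + have [_ <-] := same _ lq n2; apply/andP; split; last by rewrite /=; clear -v2 cq; lia.
    by rewrite up_cval_hole in v1.
  + have [_ <-] := same _ lp n1; apply/andP; split; last by rewrite /=; clear -v2 ; lia.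
    by rewrite up_cval_hole in v1.
  + by have [_ <-] := same _ lp n1; have [_ <-] := same _ lq n2; rewrite v1.
Qed.
End Up.

End SlideStep.

(** * Complete slides and rectification *)

Definition same_chains t h t' h' : Prop :=
  (forall n, chains_le (live t h) (inc_rel t) n <-> chains_le (live t' h') (inc_rel t') n) /\
  (forall n, chains_le (live t h) (dec_rel t) n <-> chains_le (live t' h') (dec_rel t') n).

Lemma same_chains_trans t1 h1 t2 h2 t3 h3 :
  same_chains t1 h1 t2 h2 -> same_chains t2 h2 t3 h3 -> same_chains t1 h1 t3 h3.
Proof. by move=> [a b] [c d]; split=> n; [rewrite a c | rewrite b d]. Qed.

Lemma same_chains_eq t h t' h' : (forall p, live t h p = live t' h' p) ->
  (forall p, live t h p -> cval t p = cval t' p) -> same_chains t h t' h'.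
Proof.
move=> l v; split=> n; split; apply: chains_le_map => s Ls _.
- exists (live t' h'), id; split=> // [p|p q]; rewrite -!l // => lp lq.
  by rewrite /inc_rel !v.
- exists (live t h), id; split=> // [p|p q lp lq]; first by rewrite l.
  by rewrite /inc_rel !v.
- exists (live t' h'), id; split=> // [p|p q]; rewrite -!l // => lp lq.
  by rewrite /dec_rel !v.
- exists (live t h), id; split=> // [p|p q lp lq]; first by rewrite l.
  by rewrite /dec_rel !v.
Qed.

(** Row sizes weakly decrease, so the empty rows are at the end and removing them shifts no
    index. *)
Lemma nth_filter_nonempty (t : tableau) r :
  (forall r, rsize t r.+1 <= rsize t r) ->
  nth [::] [seq s <- t | size s != 0] r = nth [::] t r.
Proof.
elim: t r => [|a t IH] r d //; rewrite [filter _ _]/=.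
have d' r' : rsize t r'.+1 <= rsize t r' by exact: (d r'.+1).
case: (posnP (size a)) => [a0|a0]; last first.
  by case: r => //= r; apply: IH.
rewrite /= IH //.
have z r' : nth [::] t r' = [::].
  apply: size0nil; elim: r' => [|r' IHr]; last by have := d' r'; rewrite /rsize IHr; lia.
  by have := d 0; rewrite /rsize /= a0; lia.
by case: r => [|r] /=; rewrite z //; apply/esym/size0nil.
Qed.

Lemma flatten_filter_nonempty (t : tableau) :
  flatten [seq s <- t | size s != 0] = flatten t.
Proof. by elim: t => [|[|x a] t IH] //=; rewrite IH. Qed.

(** Bounds the length of a slide: every move of the hole raises [r + c] by one. *)
Lemma hook_size (t : tableau) r c : (forall r', r' <= r -> c < rsize t r') ->
  r + c < size (flatten t).
Proof.
elim: t r => [|a t IH] [|r] h; rewrite /= ?size_cat.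
- by have := h 0 isT.
- by have := h 0 isT.
- by have := h 0 isT; rewrite /rsize /=; lia.
- have := h 0 isT; rewrite /rsize /= => ha.
  have : r + c < size (flatten t) by apply: IH => r' hr; apply: (h r'.+1).
  lia.
Qed.

(** [v] is the stale value stored in the starting hole; a slide loses exactly this one copy from the
    contents. *)
Record slide_spec t v h t' : Prop := SlideSpec {
  slide_wf : skew_wf t' None;
  slide_inj : live_inj t' None;
  slide_pos : all (fun s => size s != 0) t';
  slide_perm : perm_eq (flatten t) (v :: flatten t');
  slide_chains : same_chains t h t' None }.

Lemma slide_end t r c : skew_wf t (Some (r, c)) -> live_inj t (Some (r, c)) ->
  rsize t r = c.+1 -> rsize t r.+1 <= c ->
  slide_spec t (entry t r c) (Some (r, c))
    [seq s <- set_nth [::] t r (take c (nth [::] t r)) | size s != 0].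
Proof.
move=> wf inj sr su; set u := set_nth _ _ _ _.
have rt : r < size t by apply: (@rsize_row t r c); rewrite sr.
have su' r' : rsize u r' = if r' == r then c else rsize t r'.
  rewrite /rsize /u nth_set_nth /=; case: eqP => // _.
  by rewrite size_take_min; apply/minn_idPl; rewrite -/(rsize t r) sr.
have eu r' c' : c' < rsize u r' -> entry u r' c' = entry t r' c'.
  rewrite su' /entry /u nth_set_nth /=; case: eqP => // -> l.
  by rewrite nth_take.
have du r' : rsize u r'.+1 <= rsize u r'.
  rewrite !su'; have := wf_size wf r'.
  by case: (r'.+1 =P r) => [->|ne]; case: (r' =P r) => [->|ne'] //; lia.
have eF r' : nth [::] [seq s <- u | size s != 0] r' = nth [::] u r'.
  exact: nth_filter_nonempty.
have rF r' : rsize [seq s <- u | size s != 0] r' = rsize u r' by rewrite /rsize eF.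
have vF r' c' : entry [seq s <- u | size s != 0] r' c' = entry u r' c' by rewrite /entry eF.
set t' := filter _ _ in rF vF *.
have ll p : live t (Some (r, c)) p = live t' None p.
  case: p => r' c'; rewrite /live rF /cval /= vF some_pair_eq.
  have := eu r' c'; rewrite su'; case: (r' =P r) => [->|] /=.
    by rewrite sr; case: (ltnP c' c) => [l ->//|l _]; lia.
  by case: (ltnP c' (rsize t r')) => // ? _ ->.
have vv p : live t (Some (r, c)) p -> cval t p = cval t' p.
  rewrite ll => /and3P[l _ _]; rewrite rF in l.
  by rewrite /cval vF eu.
split.
- split.
  + by move=> r'; rewrite !rF.
  + move=> r' c'; rewrite rF !vF => l; have l' := ltnW l.
    rewrite !eu // => nz; move: l l'; rewrite su' => l l'.
    have lt : c'.+1 < rsize t r'.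
      by move: l; case: (r' =P r) => [->|//]; rewrite sr; lia.
    have := wf_row wf lt nz; rewrite some_pair_eq.
    by case: (r' =P r) l => *; lia.
  + move=> r' c'; rewrite rF !vF => l; have l' : c' < rsize u r' by apply: leq_trans (du r').
    rewrite !eu // => nz; move: l l'; rewrite !su' => l l'.
    have lt : c' < rsize t r'.+1.
      by move: l; case: (r'.+1 =P r) => [->|//]; rewrite sr; lia.
    have := wf_col wf lt nz; rewrite some_pair_eq.
    by case: (r'.+1 =P r) l => *; lia.
- move=> p q lp lq; rewrite -ll in lp; rewrite -ll in lq.
  by rewrite -!vv //; apply: inj.
- by rewrite /t'; apply/allP => x; rewrite mem_filter => /andP[].
- rewrite /t' flatten_filter_nonempty; apply/permP => P.
  have /permP/(_ P) := flatten_set_nth (take c (nth [::] t r)) rt.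
  rewrite -{1}(cat_take_drop c (nth [::] t r)) !count_cat -/u.
  rewrite (drop_nth 0) ?drop_oversize; rewrite -/(rsize t r) ?sr //= -/(entry t r c); lia.
- exact: same_chains_eq.
Qed.

(** The sum [fuel + (r + c)] is constant along the recursion, so when the fuel is exhausted the size
    hypothesis contradicts [hook_size]. The two non-zero hypotheses say that the hole never has an
    inner cell to its right or above it. *)
Lemma jdt_slideP fuel t r c :
  skew_wf t (Some (r, c)) -> live_inj t (Some (r, c)) -> c < rsize t r ->
  (c.+1 < rsize t r -> entry t r c.+1 <> 0) ->
  (c < rsize t r.+1 -> entry t r.+1 c <> 0) ->
  size (flatten t) < fuel + (r + c) ->
  slide_spec t (entry t r c) (Some (r, c)) (jdt_slide fuel t r c).
Proof.
elim: fuel t r c => [|fuel IH] t r c wf inj cin rnz unz lf.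
  have : r + c < size (flatten t); last by lia.
  by apply: hook_size => r' hr; apply: leq_trans (rsize_mono wf hr).
rewrite /= -/(rsize t r) -/(rsize t r.+1) -/(entry t r c.+1) -/(entry t r.+1 c).
case: ifP => [/andP[hR hx]|nR].
  have xRU : c < rsize t r.+1 -> entry t r c.+1 < entry t r.+1 c by move=> h; rewrite h in hx.
  rewrite -/(upd t r c (entry t r c.+1)).
  have wf' : skew_wf (upd t r c (entry t r c.+1)) (Some (r, c.+1)) by apply: right_wf.
  set t1 := upd _ _ _ _ in wf' *.
  have pm := flatten_upd (entry t r c.+1) cin; rewrite -/t1 in pm.
  have e1 : entry t1 r c.+1 = entry t r c.+1.
    by rewrite entry_upd xpair_eqE; case: ifP => //; lia.
  have [|||||] := IH t1 r c.+1 wf'.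
  + exact: right_inj.
  + by rewrite rsize_upd.
  + rewrite rsize_upd // => l; have l1 : c.+1 < c.+2 by [].
    have nz : entry t1 r c.+1 <> 0 by rewrite e1; apply: rnz.
    have l' : c.+2 < rsize t1 r by rewrite rsize_upd.
    by have [] := row_mono wf' l1 l' nz.
  + rewrite rsize_upd // => l; rewrite entry_upd xpair_eqE.
    case: ifP => [|_]; first lia.
    have := wf_col wf l (rnz hR); rewrite some_pair_eq; lia.
  + by move/permP: pm => /(_ predT); rewrite /= !count_predT; lia.
  move=> w i ps pe ch; split=> //.
    apply/permP => P; move/permP: pm => /(_ P); move/permP: pe => /(_ P) /=.
    by rewrite e1; lia.
  apply: same_chains_trans ch.
  by split=> n; [apply: (right_chains cin rnz unz hR xRU (fun a b => b <= a)) |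
                 apply: (right_chains cin rnz unz hR xRU (fun a b => a < b))].
case: ifP => [hU|nU]; last first.
  apply: slide_end => //; last by move: nU; lia.
  by move: nR; rewrite nU /=; lia.
have xUR : c.+1 < rsize t r -> entry t r.+1 c <= entry t r c.+1.
  by move=> h; move: nR; rewrite h hU /=; lia.
rewrite -/(upd t r c (entry t r.+1 c)).
have wf' : skew_wf (upd t r c (entry t r.+1 c)) (Some (r.+1, c)) by apply: up_wf.
set t1 := upd _ _ _ _ in wf' *.
have pm := flatten_upd (entry t r.+1 c) cin; rewrite -/t1 in pm.
have e1 : entry t1 r.+1 c = entry t r.+1 c.
  by rewrite entry_upd xpair_eqE; case: ifP => //; lia.
have nz : entry t1 r.+1 c <> 0 by rewrite e1; apply: unz.
have [|||||] := IH t1 r.+1 c wf'.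
+ exact: up_inj.
+ by rewrite rsize_upd.
+ move=> l.
  have l1 : c < c.+1 by [].
  by have [] := row_mono wf' l1 l nz.
+ move=> l.
  have := wf_col wf' l nz; rewrite some_pair_eq; lia.
+ by move/permP: pm => /(_ predT); rewrite /= !count_predT; lia.
move=> w i ps pe ch; split=> //.
  apply/permP => P; move/permP: pm => /(_ P); move/permP: pe => /(_ P) /=.
  by rewrite e1; lia.
apply: same_chains_trans ch; split=> n; split.
- exact: up_inc_bwd.
- exact: up_inc_fwd.
- exact: up_dec_bwd.
- exact: up_dec_fwd.
Qed.

(** Zeros encode inner cells. From the first non-zero entry on the values increase, so no zero can
    follow it. *)
Lemma zero_prefix (s : seq nat) c :
  (forall c, c.+1 < size s -> nth 0 s c <> 0 -> nth 0 s c < nth 0 s c.+1) ->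
  c < size s -> (nth 0 s c == 0) = (c < count (pred1 0) s).
Proof.
elim: s c => [|a s IH] c // h.
have h' c' : c'.+1 < size s -> nth 0 s c' <> 0 -> nth 0 s c' < nth 0 s c'.+1.
  by move=> l; apply: (h c'.+1).
rewrite [count _ _]/=; case: (a =P 0) => [-> | a0].
  by case: c => //= c l; rewrite IH.
have c0 : count (pred1 0) s = 0.
  case: (posnP (size s)) => [/size0nil -> //|s0].
  have := h 0 s0 a0; have := IH 0 h' s0; rewrite /=; lia.
rewrite c0; case: c => [|c] /= l; first by apply/eqP.
by rewrite IH // c0.
Qed.

Lemma last_filter_iota (P : pred nat) n r : r < n -> P r ->
  let z := last 0 [seq k <- iota 0 n | P k] in
  [/\ P z, z < n & forall k, k < n -> P k -> k <= z].
Proof.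
elim: n r => // n IH r lr Pr z.
have zE : z = if P n then n else last 0 [seq k <- iota 0 n | P k].
  by rewrite /z -addn1 iotaD filter_cat last_cat /=; case: (P n).
case: (boolP (P n)) zE => [Pn|nPn] ->; first by split=> // k; rewrite ltnS.
have rn : r < n by rewrite ltn_neqAle -ltnS lr andbT; apply: contraNneq nPn => <-.
have [h1 h2 h3] := IH r rn Pr; split=> //; first exact: ltnW.
move=> k kn Pk; apply: h3 => //; rewrite ltn_neqAle -ltnS kn andbT.
by apply: contraNneq nPn => <-.
Qed.

Lemma entry_in_flatten (t : tableau) r c : c < rsize t r -> entry t r c \in flatten t.
Proof.
move=> h; apply/flattenP; exists (nth [::] t r); last exact: mem_nth.
by apply: mem_nth; apply: rsize_row h.
Qed.

(** The slide starts at the last zero of the topmost row that has zeros: its right neighbour is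
    beyond the zero prefix and the row above has no zero at all. *)
Lemma jdt_stepP t : skew_wf t None -> live_inj t None ->
  0 < count (pred1 0) (flatten t) -> slide_spec t 0 None (jdt_step t).
Proof.
move=> wf inj; rewrite -has_count => /hasP[z /flattenP[row rt z0] /eqP ez].
rewrite ez in z0 => {z ez}.
pose P r := 0 < count (pred1 0) (nth [::] t r).
have Pr : P (index row t).
  by rewrite /P nth_index // -has_count; apply/hasP; exists 0.
have rl : index row t < size t by rewrite index_mem.
have := last_filter_iota rl Pr; rewrite /jdt_step -/P.
set r := last 0 _; move=> [P0 lr maxr].
set c := (count _ _).-1.
have pre r' c' : c' < rsize t r' -> (entry t r' c' == 0) = (c' < count (pred1 0) (nth [::] t r')).
  move=> l; apply: zero_prefix => // k lk nz.
  by have := wf_row wf lk nz; rewrite addn0.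
have cc : c.+1 = count (pred1 0) (nth [::] t r) by rewrite /c prednK.
have cin : c < rsize t r by rewrite cc /rsize; apply: count_size.
have e0 : entry t r c = 0 by apply/eqP; rewrite pre // -cc.
have [||||||] := @jdt_slideP (size (flatten t)).+1 t r c.
- split; first exact: wf_size wf.
  + by move=> r' c' l nz; apply: leq_trans (wf_row wf l nz) _; rewrite addn0 leq_addr.
  + by move=> r' c' l nz; apply: leq_trans (wf_col wf l nz) _; rewrite addn0 leq_addr.
- move=> p q /and3P[l1 _ l2] /and3P[l3 _ l4]; apply: inj; exact/and3P.
- exact: cin.
- by move=> l /eqP; rewrite pre // -cc ltnn.
- move=> l /eqP; rewrite pre // => l2.
  have l3 : r.+1 < size t by apply: rsize_row l.
  have := maxr r.+1 l3; rewrite ltnn => H; suff : false by [].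
  by apply: H; rewrite /P; apply: leq_trans l2.
- by lia.
(* The starting hole stores 0 and was not live to begin with, so declaring it a hole changes no
   chain. *)
rewrite e0 => w i ps pe ch; split=> //.
apply: same_chains_trans ch; apply: same_chains_eq => // p.
rewrite /live; case: (p.2 < _) => //=; rewrite (inj_eq Some_inj).
by case: (p =P (r, c)) => [->|//]; rewrite /cval e0.
Qed.

Lemma rectifyP t : skew_wf t None -> live_inj t None ->
  all (fun s => size s != 0) t ->
  [/\ skew_wf (rectify t) None, all (fun s => size s != 0) (rectify t),
    0 \notin flatten (rectify t),
    size (flatten (rectify t)) = count (fun x => x != 0) (flatten t)
    & same_chains t None (rectify t) None].
Proof.
rewrite /rectify; move e : (count _ _) => n.
elim: n t e => [|n IH] t e wf inj ps.
  have z : 0 \notin flatten t by rewrite -has_pred1 has_count e.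
  split=> //.
  apply/esym/eqP; rewrite -all_count; apply/allP => x xt.
  by apply: contraNneq z => <-.
have c0 : 0 < count (pred1 0) (flatten t) by rewrite e.
have [w i ps' pe ch] := jdt_stepP wf inj c0.
rewrite iterSr.
have e' : count (pred1 0) (flatten (jdt_step t)) = n.
  by move/permP: pe => /(_ (pred1 0)); rewrite e /=; lia.
have [h1 h2 h3 h4 h5] := IH _ e' w i ps'; split=> //.
  by rewrite h4; move/permP: pe => /(_ (fun x => x != 0)) ->.
exact: same_chains_trans h5.
Qed.

Lemma size_bounded_ltn (s : seq nat) n : sorted ltn s -> all (fun x => x < n) s -> size s <= n.
Proof.
move=> so al; rewrite -[n in _ <= n](size_iota 0).
apply: uniq_leq_size; first exact: sorted_uniq ltn_trans ltnn _ so.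
by move=> x /(allP al); rewrite mem_iota.
Qed.

Lemma col_mono t r r' c : skew_wf t None -> r < r' -> c < rsize t r' ->
  entry t r c <> 0 -> entry t r c < entry t r' c.
Proof.
move=> wf; elim: r' => // r' IH lr lc nz.
have lc' : c < rsize t r' by apply: leq_trans (wf_size wf r').
case: (ltnP r r') => [l|l].
  have l1 := IH l lc' nz.
  have nz' : entry t r' c <> 0 by lia.
  by have := wf_col wf lc nz'; rewrite addn0; lia.
have e : r = r' by lia.
by rewrite -e in lc *; have := wf_col wf lc nz; rewrite addn0.
Qed.

(* A special case of Greene's theorem, for tableaux of straight shape. *)
Lemma rectangle_chains t n : skew_wf t None -> all (fun s => size s != 0) t ->
  0 \notin flatten t -> size (flatten t) = 2 * n -> 0 < n ->
  (shape t == [:: n; n]) <->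
  chains_le (live t None) (inc_rel t) n /\ chains_le (live t None) (dec_rel t) 2.
Proof.
move=> wf ps z sf n0.
have nz r c : c < rsize t r -> entry t r c <> 0.
  by move=> /entry_in_flatten h e; move: z; rewrite -e h.
have lv r c : c < rsize t r -> live t None (r, c).
  by move=> h; rewrite /live h; apply/eqP/nz.
have rmono r c1 c2 : c1 < c2 -> c2 < rsize t r -> entry t r c1 < entry t r c2.
  move=> l1 l2; have l3 : c1 < rsize t r by lia.
  by have [_] := row_mono wf l1 l2 (nz _ _ l3); rewrite addn0.
have cmono r1 r2 c : r1 < r2 -> c < rsize t r2 -> entry t r1 c < entry t r2 c.
  move=> l1 l2; apply: (col_mono wf l1 l2); apply: nz.
  exact: leq_trans (rsize_mono wf (ltnW l1)).
split=> [/eqP sh|[hi hd]].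
  have r0 r : rsize t r = nth 0 [:: n; n] r.
    case: (ltnP r (size t)) => h; first by rewrite -sh /shape (nth_map [::]).
    by rewrite /rsize !nth_default // -sh size_map.
  split=> s Ls so; rewrite -(size_map (@fst nat nat)) -?(size_map (@snd nat nat)).
    (* In a straight shape columns strictly increase along an increasing chain: an entry weakly left
       of and weakly below another one cannot be larger. Rows do so along a decreasing chain by
       definition. *)
    rewrite size_map -(size_map (@snd nat nat)); apply: size_bounded_ltn.
      apply: (homo_sorted_in (P := live t None)) so => // -[p1 p2] [q1 q2].
      move=> /and3P[/= lp _ _] /and3P[/= lq _ _] /andP[/= v rw].
      rewrite ltnNge; apply/negP => le; move: v; apply/negP; rewrite -leqNgt /cval /=.
      have lp' : p2 < rsize t q1 by apply: leq_trans lp (rsize_mono wf rw).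
      have l1 : entry t q1 q2 <= entry t q1 p2.
        by move: le; rewrite leq_eqVlt => /orP[/eqP->//|l]; apply/ltnW/rmono.
      apply: leq_trans l1 _.
      by move: rw; rewrite leq_eqVlt => /orP[/eqP->//|l]; apply/ltnW/cmono.
    rewrite all_map; apply: sub_all Ls => -[p1 p2] /and3P[/= lp _ _].
    by apply: leq_trans lp _; rewrite r0; case: p1 => [|[|p1]] //=; rewrite nth_nil.
  apply: size_bounded_ltn.
    by apply: (homo_sorted_in (P := predT)) so; [move=> p q _ _ /andP[] | apply/allP].
  rewrite all_map; apply: sub_all Ls => -[p1 p2] /and3P[/= lp _ _].
  by move: lp; rewrite r0; case: p1 => [|[|p1]] //=; rewrite nth_nil.
(* The bottom row is an increasing chain and the first column a decreasing one, so the hypotheses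
   bound both lengths. *)
have h1 : rsize t 0 <= n.
  rewrite -[X in X <= _](size_iota 0) -(size_map (fun c => (0, c))); apply: hi.
    by rewrite all_map; apply/allP => c; rewrite mem_iota => /= l; apply: lv.
  apply: (homo_sorted_in (P := fun c => c < rsize t 0)); last exact: iota_ltn_sorted.
    by move=> c1 c2 _ l2 l12; rewrite /inc_rel leqnn andbT; apply: rmono.
  by apply/allP => c; rewrite mem_iota.
have pos r : r < size t -> 0 < rsize t r.
  by move=> l; have := all_nthP [::] ps r l; rewrite /rsize; lia.
have h2 : size t <= 2.
  rewrite -[X in X <= _](size_iota 0) -(size_map (fun r => (r, 0))); apply: hd.
    by rewrite all_map; apply/allP => c; rewrite mem_iota => /= l; apply/lv/pos.
  apply: (homo_sorted_in (P := fun c => c < size t)); last exact: iota_ltn_sorted.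
    by move=> c1 c2 _ l2 l12; apply/andP; split=> //; apply: cmono => //; apply: pos.
  by apply/allP => c; rewrite mem_iota.
(* At most two rows of length at most [n] must hold [2 * n] cells, so both are full. *)
have := wf_size wf 0; case: t h1 h2 sf {wf ps z nz lv rmono cmono hi hd pos} => [|a [|b []]] //=.
- by move=> _ _; lia.
- by rewrite /rsize /= cats0; lia.
- rewrite /rsize /= cats0 size_cat => h1 _ e h3; rewrite /shape /=.
  have -> : size a = n by lia.
  by have -> : size b = n by lia.
Qed.

(** * Standard tableaux and their restriction to an interval of values *)

Record standard (N : nat) (T : tableau) : Prop := Standard {
  std_row : forall r, sorted ltn (nth [::] T r);
  std_col : forall r c, c < rsize T r.+1 -> entry T r c < entry T r.+1 c;
  std_size : forall r, rsize T r.+1 <= rsize T r;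
  std_perm : perm_eq (flatten T) (iota 1 N) }.

Lemma is_SYT_standard la T : is_SYT la T -> standard (sumn la) T.
Proof.
case/and5P=> /andP[so _] /eqP sh pe rows cols.
have sz r : rsize T r = nth 0 la r.
  case: (ltnP r (size T)) => h; first by rewrite -sh /shape (nth_map [::]).
  by rewrite /rsize !nth_default // -sh size_map.
split=> //.
- move=> r; case: (ltnP r (size T)) => h; last by rewrite nth_default.
  exact: all_nthP [::] rows r h.
- move=> r c lc; have lr := rsize_row lc.
  have := allP cols r; rewrite mem_iota => /(_ (ltnW lr)) /allP; apply.
  by rewrite mem_iota.
- move=> r; rewrite !sz; case: (ltnP r.+1 (size la)) => h; last by rewrite nth_default.
  by have := sortedP 0 so r h.
Qed.

Lemma entry_inj (t : tableau) r c r' c' : uniq (flatten t) ->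
  c < rsize t r -> c' < rsize t r' -> entry t r c = entry t r' c' ->
  (r, c) = (r', c').
Proof.
elim: t r r' => [|a t IH] r r' /=; first by rewrite /rsize nth_nil.
rewrite cat_uniq => /and3P[ua /hasPn dis ut].
case: r r' => [|r] [|r'] l1 l2 e.
- congr pair; apply/eqP; rewrite -(nth_uniq 0 l1 l2 ua); exact/eqP.
- have /dis/negP[] := @entry_in_flatten t r' c' l2.
  by rewrite -[entry t _ _]e; apply: mem_nth.
- have /dis/negP[] := @entry_in_flatten t r c l1.
  by rewrite [entry t _ _]e; apply: mem_nth.
- by case: (IH r r' ut l1 l2 e) => -> ->.
Qed.

Lemma filter_le_take b (s : seq nat) : sorted ltn s ->
  [seq x <- s | x <= b] = take (count (fun x => x <= b) s) s.
Proof.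
elim: s => //= a s IH so; case: leqP => [l|l].
  by rewrite add1n /= IH // (path_sorted so).
have al : all (fun x => a < x) s := order_path_min ltn_trans so.
have -> : count (fun x => x <= b) s = 0.
  apply/eqP; rewrite -leqn0 leqNgt -has_count; apply/hasPn => x /(allP al); lia.
rewrite take0; apply/eqP; rewrite -size_eq0 size_filter -leqn0 leqNgt -has_count.
by apply/hasPn => x /(allP al); lia.
Qed.

Lemma count_le_nth b (s : seq nat) c : sorted ltn s ->
  (c < count (fun x => x <= b) s) = (c < size s) && (nth 0 s c <= b).
Proof.
move=> so; have e := filter_le_take b so; set k := count _ _ in e *.
have sk : k <= size s := count_size _ _.
apply/idP/andP => [l|[l1 l2]].
  split; first exact: leq_trans sk.
  have := mem_nth 0 (s := [seq x <- s | x <= b]) (n := c); rewrite size_filter => /(_ l).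
  by rewrite mem_filter e nth_take // => /andP[].
rewrite ltnNge; apply/negP => kc.
have : nth 0 s c \in drop k s.
  rewrite -(subnKC kc) -nth_drop; apply: mem_nth.
  by rewrite size_drop ltn_sub2r // (leq_ltn_trans kc l1).
have : count (fun x => x <= b) (drop k s) = 0.
  have : k = count (fun x => x <= b) (take k s ++ drop k s) by rewrite cat_take_drop.
  rewrite count_cat -e count_filter.
  have -> : count (predI (fun x => x <= b) (fun x => x <= b)) s = k.
    by apply: eq_count => x /=; rewrite andbb.
  by lia.
move=> c0 /= m; have : has (fun x => x <= b) (drop k s) by apply/hasP; exists (nth 0 s c).
by rewrite has_count c0.
Qed.

Section SkewRestrict.
Variables (N : nat) (T : tableau) (a b : nat).
Hypotheses (sT : standard N T) (a0 : 0 < a).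
Let t := skew_restrict T a b.
Let u := [seq [seq (if x < a then 0 else x) | x <- row & x <= b] | row <- T].

Lemma nth_skew_rows r : nth [::] u r =
  [seq (if x < a then 0 else x) | x <- nth [::] T r & x <= b].
Proof.
case: (ltnP r (size T)) => h; first by rewrite (nth_map [::]).
by rewrite !nth_default // size_map.
Qed.

Lemma rsize_skew_rows r c : (c < rsize u r) = (c < rsize T r) && (entry T r c <= b).
Proof. by rewrite /rsize nth_skew_rows size_map size_filter count_le_nth //; apply: std_row sT r. Qed.

Lemma entry_skew_rows r c : c < rsize u r ->
  entry u r c = if entry T r c < a then 0 else entry T r c.
Proof.
rewrite /entry /rsize nth_skew_rows size_map => l; rewrite (nth_map 0) //.
by rewrite filter_le_take ?nth_take //; [rewrite -size_filter | apply: std_row sT r].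
Qed.

Lemma skew_rows_size r : rsize u r.+1 <= rsize u r.
Proof.
case: (posnP (rsize u r.+1)) => [->//|p].
have : (rsize u r.+1).-1 < rsize u r.+1 by rewrite prednK.
rewrite rsize_skew_rows => /andP[l1 l2].
have : (rsize u r.+1).-1 < rsize u r; last by rewrite prednK.
rewrite rsize_skew_rows (leq_trans l1 (std_size sT r)) /=.
by apply: leq_trans l2; apply/ltnW/(std_col sT).
Qed.

Lemma nth_skew_restrict r : nth [::] t r = nth [::] u r.
Proof. exact/nth_filter_nonempty/skew_rows_size. Qed.

Lemma rsize_skew r c : (c < rsize t r) = (c < rsize T r) && (entry T r c <= b).
Proof. by rewrite -rsize_skew_rows /rsize nth_skew_restrict. Qed.

Lemma entry_skew r c : c < rsize t r ->
  entry t r c = if entry T r c < a then 0 else entry T r c.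
Proof. by rewrite /rsize nth_skew_restrict => l; rewrite -entry_skew_rows // /entry nth_skew_restrict. Qed.

Lemma skew_restrict_wf : skew_wf t None.
Proof.
split.
- by move=> r; rewrite /rsize !nth_skew_restrict; apply: skew_rows_size.
- move=> r c l; have l' := ltnW l; rewrite !entry_skew // addn0.
  move: l; rewrite rsize_skew => /andP[l _].
  have lt : entry T r c < entry T r c.+1 := sortedP 0 (std_row sT r) c l.
  by do 2!case: ifP; lia.
- move=> r c l; have l' : c < rsize t r.
    by apply: leq_trans l _; rewrite /rsize !nth_skew_restrict; apply: skew_rows_size.
  rewrite !entry_skew // addn0; move: l; rewrite rsize_skew => /andP[l _].
  by have := std_col sT l; do 2!case: ifP; lia.
Qed.

Definition in_window p := [&& p.2 < rsize T p.1, a <= cval T p & cval T p <= b].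

(** Turns chains of the skew tableau into chains of [T] with values in the interval, so the skew
    encoding can be left behind. *)
Lemma live_skew p : live t None p = in_window p.
Proof.
rewrite /live /in_window /=; case: (boolP (p.2 < rsize t p.1)) => [l|nl]; last first.
  by move: nl; rewrite rsize_skew /cval; case: (_ < _); case: (_ <= b); rewrite ?andbF.
rewrite /cval entry_skew //; move: l; rewrite rsize_skew => /andP[-> ->] /=.
by case: ifP; lia.
Qed.

Lemma cval_skew p : live t None p -> cval t p = cval T p.
Proof.
move=> l; have := l; rewrite live_skew => /and3P[_ l2 _].
by case/and3P: l => l _ _; rewrite /cval entry_skew //; move: l2; rewrite /cval; case: ifP; lia.
Qed.

Lemma standard_uniq : uniq (flatten T).
Proof. by rewrite (perm_uniq (std_perm sT)) iota_uniq. Qed.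

Lemma skew_restrict_inj : live_inj t None.
Proof.
move=> [p1 p2] [q1 q2] lp lq; rewrite !cval_skew //; move: lp lq; rewrite !live_skew.
move=> /and3P[lp _ _] /and3P[lq _ _]; exact: (entry_inj standard_uniq).
Qed.

Lemma count_skew : b <= N -> count (fun x => x != 0) (flatten t) = b.+1 - a.
Proof.
move=> bN; rewrite /t /skew_restrict flatten_filter_nonempty.
have -> : flatten u = [seq (if x < a then 0 else x) | x <- flatten T & x <= b].
  by rewrite filter_flatten map_flatten /u -map_comp.
rewrite count_map count_filter (permP (std_perm sT)) -size_filter.
rewrite -(size_iota a (b.+1 - a)); apply: perm_size; apply: uniq_perm.
- by rewrite filter_uniq // iota_uniq.
- exact: iota_uniq.
- by move=> x; rewrite mem_filter !mem_iota /=; case: ifP; lia.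
Qed.

Lemma rectangle_window n : b <= N -> b.+1 = a + 2 * n -> 0 < n ->
  (shape (rectify t) == [:: n; n]) <->
  chains_le in_window (inc_rel T) n /\ chains_le in_window (dec_rel T) 2.
Proof.
move=> bN e n0.
have ps : all (fun s => size s != 0) t by apply/allP => s; rewrite mem_filter => /andP[].
have [w p z s [ci cd]] := rectifyP skew_restrict_wf skew_restrict_inj ps.
rewrite count_skew // e in s; have {}s : size (flatten (rectify t)) = 2 * n by lia.
rewrite (rectangle_chains w p z s n0) -ci -cd.
have [h1 h2] : (forall n, chains_le (live t None) (inc_rel t) n <-> chains_le in_window (inc_rel T) n)
  /\ (forall n, chains_le (live t None) (dec_rel t) n <-> chains_le in_window (dec_rel T) n).
  have lw p' : in_window p' -> live t None p' by rewrite live_skew.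
  have wl p' : live t None p' -> in_window p' by rewrite live_skew.
  split=> k; split; apply: chains_le_map => s' Ls _.
  - by exists in_window, id; split=> // p' q' /lw lp /lw lq; rewrite /inc_rel !cval_skew.
  - by exists (live t None), id; split=> // p' q' lp lq; rewrite /inc_rel !cval_skew.
  - by exists in_window, id; split=> // p' q' /lw lp /lw lq; rewrite /dec_rel !cval_skew.
  - by exists (live t None), id; split=> // p' q' lp lq; rewrite /dec_rel !cval_skew.
by rewrite h1 h2.
Qed.
End SkewRestrict.

(** * Rectangles in the reading word *)

Lemma row_word_cons (a : seq nat) t : row_word (a :: t) = row_word t ++ a.
Proof. by rewrite /row_word rev_cons flatten_rcons. Qed.

Lemma perm_row_word t : perm_eq (row_word t) (flatten t).
Proof.
elim: t => //= a t IH; rewrite row_word_cons perm_catC perm_cat2l; exact: IH.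
Qed.

Lemma index_sorted (s : seq nat) u v : sorted ltn s -> u \in s -> v \in s ->
  u < v -> index u s < index v s.
Proof.
move=> so us vs; rewrite -{1}(nth_index 0 us) -{1}(nth_index 0 vs) => lt.
rewrite ltnNge; apply/negP => le; move: lt; apply/negP; rewrite -leqNgt.
move: le; rewrite leq_eqVlt => /orP[/eqP->//|l].
by apply/ltnW/(sorted_ltn_nth ltn_trans 0 so); rewrite // inE index_mem.
Qed.

Lemma index_row_word t u v : uniq (flatten t) -> all (sorted ltn) t ->
  u \in flatten t -> v \in flatten t -> u < v ->
  (index u (row_word t) < index v (row_word t)) = (row_of t v <= row_of t u).
Proof.
elim: t => // a t IH; rewrite /= cat_uniq => /and3P[ua /hasPn dis ut] /andP[sa st].
rewrite !mem_cat row_word_cons /row_of /= !index_cat !(perm_mem (perm_row_word t)).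
have nm w : w \in a -> w \in flatten t = false.
  by move=> wa; apply/negbTE/negP => /dis; rewrite /= wa.
case: (boolP (u \in a)) => ua'; case: (boolP (v \in a)) => va' /= ut' vt' lt.
- by rewrite !nm // ltn_add2l index_sorted.
- have : index v (row_word t) < size (row_word t).
    by rewrite index_mem (perm_mem (perm_row_word t)).
  by rewrite (nm u) // vt' => h; rewrite ltnNge ltnW // ltn_addr.
- have : index u (row_word t) < size (row_word t).
    by rewrite index_mem (perm_mem (perm_row_word t)).
  by rewrite (nm v) // ut' => h; rewrite ltn_addr.
- by rewrite ut' vt' IH.
Qed.

Definition val_inc (w : seq nat) : rel nat :=
  fun u v => (u < v) && (index u w < index v w).
Definition val_dec (w : seq nat) : rel nat :=
  fun u v => (u < v) && (index v w < index u w).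

Section Values.
Variables (N : nat) (T : tableau).
Hypothesis sT : standard N T.
Let pi := row_word T.

Lemma mem_flatten v : (v \in flatten T) = (0 < v <= N).
Proof. by rewrite (perm_mem (std_perm sT)) mem_iota add1n ltnS. Qed.

Lemma mem_pi v : (v \in pi) = (0 < v <= N).
Proof. by rewrite (perm_mem (perm_row_word T)) mem_flatten. Qed.

Lemma pi_uniq : uniq pi.
Proof. by rewrite (perm_uniq (perm_row_word T)) (standard_uniq sT). Qed.

Lemma pi_index_inj u v : 0 < u <= N -> index u pi = index v pi -> u = v.
Proof.
rewrite -mem_pi => hu e; apply: (index_inj 0 hu _ e).
by rewrite -index_mem -e index_mem.
Qed.

Lemma pi_index u v : 0 < u <= N -> 0 < v <= N -> u < v ->
  (index u pi < index v pi) = (row_of T v <= row_of T u).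
Proof.
move=> hu hv; apply: index_row_word; rewrite ?mem_flatten // ?(standard_uniq sT) //.
by apply/(all_nthP [::]) => r _; apply: std_row sT r.
Qed.

Lemma pi_index_gt u v : 0 < u <= N -> 0 < v <= N -> u < v ->
  (index v pi < index u pi) = (row_of T u < row_of T v).
Proof.
move=> hu hv lt; have := pi_index hu hv lt.
case: (ltngtP (index u pi) (index v pi)) => [||e]; [lia|lia|].
by have := pi_index_inj hu e; lia.
Qed.

Definition cell_of v := (row_of T v, index v (nth [::] T (row_of T v))).

Lemma cell_ofP v : 0 < v <= N ->
  (cell_of v).2 < rsize T (cell_of v).1 /\ cval T (cell_of v) = v.
Proof.
rewrite -mem_flatten => /flattenP[row rt vr].
have h : has (fun row => v \in row) T by apply/hasP; exists row.
have vi := nth_find [::] h.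
by rewrite /cell_of /cval /rsize /entry /= index_mem; split=> //; apply: nth_index.
Qed.

Lemma cval_range p : p.2 < rsize T p.1 -> 0 < cval T p <= N.
Proof. by move=> h; rewrite -mem_flatten; apply: entry_in_flatten. Qed.

Lemma row_of_cval p : p.2 < rsize T p.1 -> row_of T (cval T p) = p.1.
Proof.
case: p => r c /= l; have [l2 e2] := cell_ofP (cval_range (p := (r, c)) l).
by have [] := entry_inj (standard_uniq sT) l2 l e2.
Qed.

Lemma window_val_chains a b n : 0 < a -> b <= N ->
  (chains_le (in_window T a b) (inc_rel T) n <->
   chains_le (fun v => a <= v <= b) (val_inc pi) n) /\
  (chains_le (in_window T a b) (dec_rel T) n <->
   chains_le (fun v => a <= v <= b) (val_dec pi) n).
Proof.
move=> a0 bN.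
have rg v : a <= v <= b -> 0 < v <= N by lia.
have cw v : a <= v <= b -> in_window T a b (cell_of v).
  by move=> h; have [h1 h2] := cell_ofP (rg _ h); rewrite /in_window h1 h2.
have wv p : in_window T a b p -> a <= cval T p <= b by case/and3P=> _ -> ->.
have wr p : in_window T a b p -> row_of T (cval T p) = p.1.
  by case/and3P=> h _ _; apply: row_of_cval.
split; split; apply: chains_le_map => s Ls _.
- exists (fun v => a <= v <= b), cell_of; split=> // p q hp hq /andP[v].
  rewrite pi_index ?rg // => r.
  by rewrite /inc_rel !(cell_ofP _).2 ?rg // v.
- exists (in_window T a b), (cval T); split=> // p q hp hq /andP[v r].
  by rewrite /val_inc v pi_index ?rg ?wv // !wr.
- exists (fun v => a <= v <= b), cell_of; split=> // p q hp hq /andP[v].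
  rewrite pi_index_gt ?rg // => r.
  by rewrite /dec_rel !(cell_ofP _).2 ?rg // v.
- exists (in_window T a b), (cval T); split=> // p q hp hq /andP[v r].
  by rewrite /val_dec v pi_index_gt ?rg ?wv // !wr.
Qed.

Lemma has_rectangleP a b n : b.+1 = a + 2 * n -> 0 < n ->
  has_rectangle N T a b <->
  [/\ 0 < a, b <= N, chains_le (fun v => a <= v <= b) (val_inc pi) n
    & chains_le (fun v => a <= v <= b) (val_dec pi) 2].
Proof.
move=> e n0; rewrite /has_rectangle.
have -> : (b - a).+1./2 = n by lia.
have -> : odd (b - a) by lia.
have -> : a <= b by lia.
case: (posnP a) => [->|a0]; first by split=> [|[]].
case: (leqP b N) => [bN|_]; last by split=> [|[]].
rewrite /= (rectangle_window sT a0 bN e n0).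
have [-> _] := window_val_chains n a0 bN; have [_ ->] := window_val_chains 2 a0 bN.
by split=> [[]|[]].
Qed.
End Values.

Lemma val_inc_trans w : transitive (val_inc w).
Proof.
by move=> v u z /andP[a b] /andP[c d]; rewrite /val_inc (ltn_trans a c) (ltn_trans b d).
Qed.

(** All increasing subsequences exhibited later are two runs of consecutive values, so beyond the
    order inside each run only the junction has to be compared. *)
Lemma two_runs_sorted w a s c t :
  (forall x y, a <= x -> x < y -> y < a + s -> index x w < index y w) ->
  (forall x y, c <= x -> x < y -> y < c + t -> index x w < index y w) ->
  (0 < s -> 0 < t -> a + s <= c /\ index (a + s).-1 w < index c w) ->
  sorted (val_inc w) (iota a s ++ iota c t).
Proof.
move=> h1 h2 h3.
have run b n : (forall x y, b <= x -> x < y -> y < b + n -> index x w < index y w) ->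
    sorted (val_inc w) (iota b n).
  move=> h; apply: (@sub_in_sorted _ (fun x => b <= x < b + n) ltn); last exact: iota_ltn_sorted.
    move=> x y hx hy xy; rewrite /val_inc [_ < _]xy.
    by apply: h => //; [case/andP: hx | case/andP: hy].
  by apply/allP => x; rewrite mem_iota.
rewrite (sorted_pairwise (@val_inc_trans w)) pairwise_cat.
rewrite -!(sorted_pairwise (@val_inc_trans w)) !run // !andbT.
apply/allrelP => x y; rewrite !mem_iota => hx hy.
have [s0 t0] : 0 < s /\ 0 < t by clear -hx hy; lia.
have [ac lt] := h3 s0 t0.
rewrite /val_inc; apply/andP; split; first by clear -hx hy ac; lia.
have l1 : index x w <= index (a + s).-1 w.
  by case: (x =P (a + s).-1) => [->//|ne]; apply/ltnW/h1; clear -hx ne; lia.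
have l2 : index c w <= index y w.
  by case: (c =P y) => [->//|ne]; apply/ltnW/h2; clear -hy ne; lia.
exact: leq_ltn_trans l1 (leq_trans lt l2).
Qed.

(** * Row insertion *)

Lemma subseq_rconsP (T : eqType) (s w : seq T) v x :
  subseq (rcons s v) (rcons w x) -> subseq (rcons s v) w \/ v = x /\ subseq s w.
Proof.
rewrite -subseq_rev !rev_rcons /= -[subseq (rcons s v) w]subseq_rev rev_rcons.
by case: (v =P x) => [->|_]; rewrite ?subseq_rev; [right | left].
Qed.

Lemma ins_row_bump (a : seq nat) t x : let k := find (fun y => x < y) a in
  k != size a ->
  exists y R1 R2, [/\ a = R1 ++ y :: R2, x < y, all (fun z => z <= x) R1 &
    ins_row (a :: t) x = (R1 ++ x :: R2) :: ins_row t y].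
Proof.
move=> k nk; have lk : k < size a by rewrite ltn_neqAle nk find_size.
exists (nth 0 a k), (take k a), (drop k.+1 a); split.
- by rewrite -drop_nth // cat_take_drop.
- by apply: (nth_find 0 (a := fun y => x < y)); rewrite has_find.
- apply/(all_nthP 0) => j; rewrite size_take lk => lj; rewrite nth_take // leqNgt.
  by apply/negbT/(before_find 0 lj).
- by rewrite /= -/k (negbTE nk) set_nthE lk.
Qed.

Lemma ins_row_append (a : seq nat) t x :
  find (fun y => x < y) a = size a ->
  all (fun z => z <= x) a /\ ins_row (a :: t) x = rcons a x :: t.
Proof.
move=> e; rewrite /= e eqxx; split=> //; apply/allP => y ya; rewrite leqNgt.
have : ~~ has (fun y => x < y) a by rewrite has_find e ltnn.
by move/hasPn; apply.
Qed.

Lemma perm_ins_row t x : perm_eq (flatten (ins_row t x)) (x :: flatten t).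
Proof.
elim: t x => // a t IH x.
case: (find (fun y => x < y) a =P size a) => [e|/eqP ne].
  by have [_ ->] := ins_row_append t e; apply/permP => P; rewrite /= -cats1 !count_cat /=; lia.
have [y [R1 [R2 [-> _ _ ->]]]] := ins_row_bump t ne; apply/permP => P.
by move/permP: (IH y) => /(_ P); rewrite /= !count_cat /=; lia.
Qed.

Lemma ins_row_sorted t x : all (sorted ltn) t -> uniq (x :: flatten t) ->
  all (sorted ltn) (ins_row t x).
Proof.
elim: t x => // a t IH x; rewrite {1}[all _ _]/= => /andP[sa st].
rewrite cons_uniq [flatten _]/= mem_cat negb_or cat_uniq.
move=> /andP[/andP[xa xt] /and3P[ua /hasPn dis ut]].
case: (find (fun y => x < y) a =P size a) => [e|/eqP ne].
  have [al ->] := ins_row_append t e; rewrite /= st andbT.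
  case: a sa al xa {IH ua dis e} => //= b a sa /andP[lb al].
  rewrite inE negb_or => /andP[nb na]; rewrite rcons_path sa /=.
  have := mem_last b a; rewrite inE => /orP[/eqP->|la].
    by rewrite ltn_neqAle lb andbT eq_sym.
  by rewrite ltn_neqAle (allP al) // andbT; apply: contraNneq na => <-.
have [y [R1 [R2 [ea lxy al ->]]]] := ins_row_bump t ne.
have yt : y \notin flatten t.
  by apply/negP => /dis /=; rewrite ea mem_cat mem_head orbT.
apply/andP; split; last by apply: IH; rewrite ?cons_uniq ?yt.
move: sa; rewrite ea !(sorted_pairwise ltn_trans) !pairwise_cat !pairwise_cons /=.
rewrite !allrel_consr => /and3P[/andP[h1 h2] h3 /andP[h4 h5]].
rewrite h2 h3 h5 !andbT /=; apply/andP; split.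
  apply/allP => z zR; rewrite /= ltn_neqAle (allP al) // andbT.
  by apply: contraNneq xa => <-; rewrite ea mem_cat zR.
by apply: sub_all h4 => z; apply: ltn_trans.
Qed.

Definition pair_pred d := [pred v : nat | (v == d) || (v == d.+1)].

(* A bump only exchanges letters [u < v] for which some letter strictly
   between them is present, so it never exchanges [d] and [d+1]. *)
Lemma ins_row_pair t x d : all (sorted ltn) t -> uniq (x :: flatten t) ->
  filter (pair_pred d) (row_word (ins_row t x)) =
  filter (pair_pred d) (rcons (row_word t) x).
Proof.
elim: t x => // a t IH x; rewrite {1}[all _ _]/= => /andP[sa st].
rewrite cons_uniq [flatten _]/= mem_cat negb_or cat_uniq.
move=> /andP[/andP[xa xt] /and3P[ua /hasPn dis ut]].
case: (find (fun y => x < y) a =P size a) => [e|/eqP ne].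
  have [_ ->] := ins_row_append t e.
  by rewrite !row_word_cons rcons_cat.
have [y [R1 [R2 [ea lxy al ->]]]] := ins_row_bump t ne.
have yt : y \notin flatten t.
  by apply/negP => /dis /=; rewrite ea mem_cat mem_head orbT.
have uy : uniq (y :: flatten t) by rewrite cons_uniq yt.
rewrite !row_word_cons filter_cat IH // -!cats1 !filter_cat ea -!catA; congr cat.
move: sa; rewrite ea !(sorted_pairwise ltn_trans) !pairwise_cat !pairwise_cons.
rewrite !allrel_consr => /and3P[/andP[h1 h2] h3 /andP[h4 h5]].
have R1x z : z \in R1 -> z < x.
  move=> zR; rewrite ltn_neqAle (allP al) // andbT.
  by apply: contraNneq xa => <-; rewrite ea mem_cat zR.
rewrite /ltn /= in h4.
(* The words to compare end in [y R1 x R2] and [R1 y R2 x]: [y] passes [R1] and [x] passes [R2].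
   Letters of [R1] are below [x < y] and letters of [R2] above [y > x], so every exchanged pair
   differs by at least two. *)
have F1 : pair_pred d y -> filter (pair_pred d) R1 = [::].
  move=> qy; apply/eqP; rewrite -(negbK (_ == _)) -has_filter; apply/hasPn => z /R1x zx.
  by move: qy; rewrite /=; clear -zx lxy; lia.
have F2 : pair_pred d x -> filter (pair_pred d) R2 = [::].
  move=> qx; apply/eqP; rewrite -(negbK (_ == _)) -has_filter; apply/hasPn => z zR.
  by have := allP h4 z zR; move: qx; rewrite /=; clear -lxy; lia.
move: (pair_pred d) F1 F2 => Q F1 F2; rewrite !filter_cat /=.
case: (boolP (Q y)) => [/F1 e1|_]; case: (boolP (Q x)) => [/F2 e2|_];
  by rewrite ?e1 ?e2 /= ?cats0 -?catA.
Qed.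

Lemma RSK_P_rcons w x : RSK_P (rcons w x) = ins_row (RSK_P w) x.
Proof. by rewrite /RSK_P foldl_rcons. Qed.

Lemma RSK_P_spec w : uniq w ->
  [/\ all (sorted ltn) (RSK_P w), perm_eq (flatten (RSK_P w)) w &
   forall d, filter (pair_pred d) (row_word (RSK_P w)) = filter (pair_pred d) w].
Proof.
elim/last_ind: w => [|w x IH] //; rewrite rcons_uniq => /andP[xw uw].
have [s p f] := IH uw.
have u : uniq (x :: flatten (RSK_P w)) by rewrite /= (perm_mem p) xw (perm_uniq p).
rewrite RSK_P_rcons; split.
- exact: ins_row_sorted.
- rewrite (perm_trans (perm_ins_row _ _)) // perm_sym perm_rcons perm_sym perm_cons.
  exact: p.
- by move=> d; rewrite ins_row_pair // -!cats1 !filter_cat f.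
Qed.

(** An insertion only lowers the entries at given positions of the first row, and leaves values at
    most [x] at all positions up to the one where [x] lands. These are the two facts needed to
    induct on the word. *)
Lemma first_row_ins t x k : let row := nth [::] t 0 in
  let row' := nth [::] (ins_row t x) 0 in
  k <= find (fun y => x < y) row ->
  (k < size row') && (nth 0 row' k <= x) /\
  forall j, j < size row -> (j < size row') && (nth 0 row' j <= nth 0 row j).
Proof.
case: t => [|a t] /=; first by case: k => // _; split=> [|[]] //; apply: leqnn.
case: (find (fun y => x < y) a =P size a) => [e|/eqP ne] /= lk.
  have [al _] := ins_row_append t e; rewrite e in lk.
  rewrite size_rcons; split.
    rewrite ltnS lk nth_rcons; case: ltnP => lk2; first exact/(allP al)/mem_nth.
    by rewrite eqn_leq lk lk2 leqnn.
  by move=> j lj; rewrite nth_rcons lj leqnn andbT; lia.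
have lf : find (fun y => x < y) a < size a by rewrite ltn_neqAle ne find_size.
have hs : has (fun y => x < y) a by rewrite has_find.
rewrite size_set_nth (maxn_idPr lf); split.
  rewrite (leq_ltn_trans lk lf) nth_set_nth /=; case: eqP => // nk.
  have lk' : k < find (fun y => x < y) a by lia.
  by rewrite leqNgt (before_find 0 lk').
move=> j lj; rewrite lj nth_set_nth /=; case: eqP => [->|//].
exact/ltnW/(nth_find 0 hs).
Qed.

(** The bound on the entry at position [size s] is what carries the induction; the length bound
    alone would not say where the next letter is inserted. *)
Lemma schensted w s v : uniq w -> sorted ltn (rcons s v) -> subseq (rcons s v) w ->
  let row := nth [::] (RSK_P w) 0 in
  (size s < size row) && (nth 0 row (size s) <= v).
Proof.
elim/last_ind: w s v => [|w x IH] s v; first by case: s.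
move=> uw so /subseq_rconsP sub; cbv zeta.
have uw' : uniq w by move: uw; rewrite rcons_uniq => /andP[].
rewrite RSK_P_rcons; case: sub => [sub|[vx sub]].
  have /andP[h1 h2] := IH _ _ uw' so sub.
  have [_] := @first_row_ins (RSK_P w) x 0 isT; cbv zeta.
  move=> /(_ _ h1) /andP[-> h3].
  exact: leq_trans h3 h2.
rewrite vx in so *.
(* By induction the position just before [size s] holds a value at most the last letter of [s],
   which is below [x]; so [x] cannot land before position [size s]. *)
suff lk : size s <= find (fun y => x < y) (nth [::] (RSK_P w) 0).
  by have [] := first_row_ins lk.
case/lastP: s so sub => // s u so sub; rewrite size_rcons.
have so' : sorted ltn (rcons s u).
  by move: so; rewrite -[rcons (rcons _ _) _]cats1 => /cat_sorted2[].
have /andP[h1 h2] := IH _ _ uw' so' sub.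
have ux : u < x.
  move: so; rewrite (sorted_pairwise ltn_trans) -cats1 pairwise_cat => /and3P[/allrelP h _ _].
  by apply: h; rewrite ?mem_rcons ?mem_head.
have [so2 _ _] := RSK_P_spec uw'.
have srow : sorted ltn (nth [::] (RSK_P w) 0).
  by case: (RSK_P w) so2 => //= a t /andP[].
set row := nth _ _ _ in h1 h2 srow *; rewrite ltnNge; apply/negP => le.
have hs : has (fun y => x < y) row by rewrite has_find; apply: leq_ltn_trans le h1.
have := nth_find 0 hs; set k := find _ _ in le * => xk.
have : nth 0 row k <= nth 0 row (size s).
  move: le; rewrite leq_eqVlt => /orP[/eqP->//|l].
  by apply/ltnW/(sorted_ltn_nth ltn_trans 0 srow); rewrite // inE; lia.
lia.
Qed.

Lemma schensted_size w s : uniq w -> sorted ltn s -> subseq s w ->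
  size s <= size (nth [::] (RSK_P w) 0).
Proof.
move=> uw; case/lastP: s => // s v so sub.
by rewrite size_rcons; have /andP[] := schensted uw so sub.
Qed.

(** * Dyck pattern intervals as bracket sequences *)

Lemma subseq_of_index (w s : seq nat) : uniq w -> {subset s <= w} ->
  sorted (fun u v => index u w < index v w) s -> subseq s w.
Proof.
move=> uw sw so; set e := fun u v => _ in so.
have te : transitive e by move=> y x z; apply: ltn_trans.
have ie : irreflexive e by move=> x; apply: ltnn.
apply/subseq_uniqP => //; apply: (irr_sorted_eq te ie) => //; last first.
  move=> x; rewrite mem_filter andb_idr // => /sw //.
apply: sorted_filter => //.
apply/(sortedP 0) => j lj; have lj2 := ltnW lj; by rewrite /e !index_uniq.
Qed.

Lemma index_filter_lt (P : pred nat) (w : seq nat) u v : P u -> P v ->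
  (index u (filter P w) < index v (filter P w)) = (index u w < index v w).
Proof.
move=> Pu Pv; elim: w => //= a w IH.
case: (boolP (P a)) => [Pa|nPa] /=.
  by case: eqP => // _; case: eqP => // _; rewrite !ltnS.
have -> : (a == u) = false by apply/negbTE; apply: contraNneq nPa => ->.
have -> : (a == v) = false by apply/negbTE; apply: contraNneq nPa => ->.
by rewrite ltnS.
Qed.

(** [dyck_ballot] gives the opening bracket [i+m+1+j] the later closing bracket [i+j+1] as a
    partner. This pairing need not be the true bracketing, but it shows that all opening brackets
    get matched. *)
Record dyck_order (pos : nat -> nat) (i m : nat) : Prop := DyckOrder {
  dyck_low : forall x y, i <= x -> x < y -> y <= i + m -> pos x < pos y;
  dyck_high : forall x y, i + m < x -> x < y -> y <= i + 2 * m -> pos x < pos y;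
  dyck_ballot : forall j, j < m -> pos (i + m + 1 + j) < pos (i + j + 1) }.

Lemma adjacent_mono (pos : nat -> nat) a b :
  (forall d, a <= d -> d < b -> pos d < pos d.+1) ->
  forall x y, a <= x -> x < y -> y <= b -> pos x < pos y.
Proof.
move=> h x y ax; elim: y => // y IH; rewrite ltnS leq_eqVlt => /orP[/eqP<-|xy] yb.
  by apply: h => //; lia.
by apply: ltn_trans (IH xy (ltnW yb)) (h _ _ _) => //; lia.
Qed.

Lemma dyck_interval_order N pi i m : uniq pi ->
  (forall v, 0 < v <= N -> v \in pi) -> dyck_interval N pi i m ->
  dyck_order (index^~ pi) i m.
Proof.
move=> up mp /and4P[m0 i0 iN /eqP eP].
set Q := fun x => _ in eP; set w := filter Q pi in eP.
have uw : uniq w by rewrite filter_uniq.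
have wm v : Q v -> v \in w.
  by move=> q; rewrite mem_filter q mp //; move: q; rewrite /Q; lia.
have iw u v : Q u -> Q v -> (index u pi < index v pi) = (index u w < index v w).
  by move=> qu qv; rewrite index_filter_lt.
have [so pe fi] := RSK_P_spec uw; rewrite eP in so pe fi.
set P := [:: _; _] in so pe fi.
have uP : uniq (flatten P) by rewrite (perm_uniq pe).
(* Insertion preserves the order of consecutive values only; monotonicity on the two runs is
   assembled from these with [adjacent_mono]. *)
have adj d : i <= d -> d < i + 2 * m ->
    (index d pi < index d.+1 pi) = (row_of P d.+1 <= row_of P d).
  move=> h1 h2; have q1 : Q d by rewrite /Q; lia.
  have q2 : Q d.+1 by rewrite /Q; lia.
  rewrite iw // -index_row_word ?(perm_mem pe) ?wm //.
  rewrite -(index_filter_lt (P := pair_pred d)) /= ?eqxx ?orbT //.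
  by rewrite -[RHS](index_filter_lt (P := pair_pred d)) /= ?eqxx ?orbT // fi.
have rl v : i <= v -> v <= i + m -> row_of P v = 0.
  move=> h1 h2; have : v \in iota i m.+1 by rewrite mem_iota; clear -h1 h2; lia.
  by rewrite /row_of /P; move: (iota i _) => A /= ->.
have rh v : i + m < v -> v <= i + 2 * m -> row_of P v = 1.
  move=> h1 h2; have : v \in iota (i + m).+1 m by rewrite mem_iota; clear -h1 h2; lia.
  have : v \notin iota i m.+1 by rewrite mem_iota; clear -h1 h2; lia.
  by rewrite /row_of /P; move: (iota i _) (iota _ m) => A B /= /negbTE-> ->.
have low : forall x y, i <= x -> x < y -> y <= i + m -> index x pi < index y pi.
  apply: (adjacent_mono (pos := index^~ pi)) => d h1 h2.
  by rewrite adj ?rl //; lia.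
have high : forall x y, i + m < x -> x < y -> y <= i + 2 * m -> index x pi < index y pi.
  apply: (adjacent_mono (pos := index^~ pi)) => d h1 h2.
  by rewrite adj ?rh //; lia.
split=> // j jm; rewrite ltnNge leq_eqVlt negb_or; apply/andP; split.
  apply/eqP => e; have : i + j + 1 = i + m + 1 + j; last by lia.
  by apply: (index_inj 0 _ _ e); apply: mp; lia.
apply/negP => lt.
(* If the ballot condition failed at [j], then [i..i+j+1] followed by [i+m+1+j..i+2m] would be
   increasing of length [m + 2], while the first row has length [m + 1]. *)
have := @schensted_size w (iota i j.+2 ++ iota (i + m + 1 + j) (m - j)) uw.
rewrite eP /P /= size_cat !size_iota /=.
suff [h1 h2] : sorted ltn (iota i j.+2 ++ iota (i + m + 1 + j) (m - j)) /\
    subseq (iota i j.+2 ++ iota (i + m + 1 + j) (m - j)) w by move/(_ h1 h2); lia.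
have se : sorted (val_inc pi) (iota i j.+2 ++ iota (i + m + 1 + j) (m - j)).
  apply: two_runs_sorted.
  - by move=> x y h1 h2 h3; apply: low => //; clear -h3 jm; lia.
  - by move=> x y h1 h2 h3; apply: high => //; clear -h1 h3 jm; lia.
  - move=> _ _; split; first by clear -jm; lia.
    by have -> : (i + j.+2).-1 = i + j + 1 by clear; lia.
have sQ : all Q (iota i j.+2 ++ iota (i + m + 1 + j) (m - j)).
  by apply/allP => x; rewrite mem_cat !mem_iota /Q; clear -jm; lia.
split; first by apply: sub_sorted se => x y /andP[].
apply: subseq_of_index => //; first by move=> x /(allP sQ); apply: wm.
apply: (@sub_in_sorted _ Q (val_inc pi)) => //.
by move=> x y qx qy /andP[_]; rewrite iw.
Qed.

(** * The crystal operator and standardization *)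

(* [i + k] is the unbracketed letter; [dyck_ballot] describes the bracketing
   to the right of it and [split_before] the bracketing to its left. *)
Record dyck_split (pos : nat -> nat) (i m k : nat) : Prop := DyckSplit {
  split_le : k <= m;
  split_before : forall j, j < k -> pos (i + m + 1 + j) < pos (i + j);
  split_after : k < m -> pos (i + k) < pos (i + m + 1 + k) }.

(** [k] is the first index at which the closing bracket [i+k] precedes the opening bracket
    [i+m+1+k], or [m] if this never happens; minimality gives [split_before]. *)
Lemma dyck_split_exists pos i m :
  (forall x y, i <= x <= i + 2 * m -> i <= y <= i + 2 * m -> pos x = pos y -> x = y) ->
  exists k, dyck_split pos i m k.
Proof.
move=> inj; pose P k := (k == m) || (pos (i + k) < pos (i + m + 1 + k)).
have ex : exists k, P k by exists m; rewrite /P eqxx.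
case: (ex_minnP ex) => k Pk mn; exists k.
have km : k <= m by apply: mn; rewrite /P eqxx.
split=> // [j jk|lt]; last by case/orP: Pk => // /eqP; clear -lt; lia.
have : ~~ P j by apply/negP => /mn; clear -jk; lia.
rewrite negb_or -leqNgt leq_eqVlt => /andP[_ /orP[/eqP e|//]].
have h1 : i <= i + m + 1 + j <= i + 2 * m by clear -jk km; lia.
have h2 : i <= i + j <= i + 2 * m by clear -jk km; lia.
by have := inj _ _ h1 h2 e; clear; lia.
Qed.

Section Split.
Variables (pos : nat -> nat) (i m k : nat).
Hypotheses (dy : dyck_order pos i m) (sp : dyck_split pos i m k).

Lemma split_low v : i <= v <= i + m -> (pos v < pos (i + k)) = (v < i + k).
Proof.
move=> h; have km := split_le sp; case: (ltngtP v (i + k)) => [l|l|->].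
- by apply: (dyck_low dy); clear -h l km; lia.
- have : pos (i + k) < pos v by apply: (dyck_low dy); clear -h l km; lia.
  by clear; lia.
- by rewrite ltnn.
Qed.

(** The opening bracket [i+m+k] precedes [i+k-1], hence [i+k], by [split_before], and the next one
    follows [i+k] by [split_after]; the rest is monotonicity of the opening brackets. *)
Lemma split_high v : i + m < v <= i + 2 * m -> (pos v < pos (i + k)) = (v <= i + m + k).
Proof.
move=> h; have km := split_le sp; case: (leqP v (i + m + k)) => l; last first.
  have k1 : k < m by clear -h l; lia.
  have h1 := split_after sp k1.
  have : pos (i + m + 1 + k) <= pos v; last by clear -h1; lia.
  case: (i + m + 1 + k =P v) => [->//|ne].
  by apply/ltnW/(dyck_high dy); clear -h l ne; lia.
have k1 : k.-1 < k by clear -h l; lia.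
have h1 := split_before sp k1.
have h2 : pos (i + k.-1) < pos (i + k) by apply: (dyck_low dy); clear -km k1; lia.
apply: leq_ltn_trans (ltn_trans h1 h2).
case: (v =P i + m + 1 + k.-1) => [->//|ne].
by apply/ltnW/(dyck_high dy); clear -h l ne km k1; lia.
Qed.
End Split.

(** If no prefix of [A] uses up more open brackets than are available, [A] contains no free letter
    [i], so [best] passes through unchanged. *)
Lemma rightmost_free_balanced (i : nat) (A B : seq nat) pos open best :
  (forall q, count (pred1 i) (take q A) <= open + count (pred1 i.+1) (take q A)) ->
  rightmost_free_i i (A ++ B) pos open best =
  rightmost_free_i i B (pos + size A)
    (open + count (pred1 i.+1) A - count (pred1 i) A) best.
Proof.
elim: A pos open => [|a A IH] pos open H /=; first by rewrite !addn0 subn0.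
have H1 q : (a == i) + count (pred1 i) (take q A) <=
    open + ((a == i.+1) + count (pred1 i.+1) (take q A)) := H q.+1.
case: (a =P i.+1) H1 => [->|n1] H1.
  have ne : (i.+1 == i) = false by clear; lia.
  rewrite ne in H1 *; rewrite IH; last by move=> q; have := H1 q; clear; lia.
  by rewrite add1n add0n !addSnnS.
case: (a =P i) H1 => [_|n2] H1.
  have op : 0 < open by have := H1 0; rewrite take0 /=; clear; lia.
  rewrite op IH; last by move=> q; have := H1 q; clear -op; lia.
  by rewrite -(prednK op) [in RHS]addSn add1n subSS addSnnS.
by rewrite IH // !add0n addSnnS.
Qed.

Lemma mem_take_drop (s : seq nat) q n v : uniq s -> v \in s ->
  (v \in take q (drop n s)) = (n <= index v s < n + q).
Proof.
move=> us vs; rewrite take_drop.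
have e1 : (v \in take (q + n) s) = (index v s < n + q) by rewrite addnC in_take.
have e2 : (v \in take n s) = (index v s < n) by rewrite in_take.
have ut : uniq (take (q + n) s) by apply: take_uniq.
move: e1; rewrite -{1}(cat_take_drop n (take (q + n) s)) mem_cat take_takel ?leq_addl // e2.
move: ut; rewrite -{1}(cat_take_drop n (take (q + n) s)) cat_uniq take_takel ?leq_addl //.
move=> /and3P[_ /hasPn dis _].
case: (boolP (v \in drop n (take (q + n) s))) => [vd|_].
  by have := dis _ vd; rewrite /= e2 -leqNgt => -> <-; rewrite orbT.
by rewrite orbF => <-; rewrite [n <= _]leqNgt; case: (index v s < n).
Qed.

Lemma count_le_inj (P Q : pred nat) (f : nat -> nat) (s : seq nat) :
  uniq s -> {in P &, injective f} ->
  (forall v, v \in s -> P v -> (f v \in s) && Q (f v)) -> count P s <= count Q s.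
Proof.
move=> us inj h; rewrite -!size_filter -(size_map f); apply: uniq_leq_size.
  rewrite map_inj_in_uniq ?filter_uniq // => x y.
  by rewrite !mem_filter => /andP[px _] /andP[py _]; apply: inj.
by move=> _ /mapP[v + ->]; rewrite !mem_filter => /andP[pv vs]; rewrite andbC h.
Qed.

Lemma iota_count_lt v N : 0 < v <= N -> (count (fun x => x < v) (iota 1 N)).+1 = v.
Proof.
move=> h; rewrite -size_filter.
have -> : size [seq x <- iota 1 N | x < v] = size (iota 1 v.-1).
  apply: perm_size; apply: uniq_perm; rewrite ?filter_uniq ?iota_uniq //.
  by move=> x; rewrite mem_filter !mem_iota; clear -h; lia.
by rewrite size_iota prednK //; case/andP: h.
Qed.

Lemma count_nth (P : pred nat) (s : seq nat) :
  count P s = count (fun q => P (nth 0 s q)) (iota 0 (size s)).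
Proof. by rewrite -{1}(mkseq_nth 0 s) count_map. Qed.

(** Standardization is the ranking of positions by letter, ties broken from left to right. A
    permutation with the same order equals it, since an entry is one more than the number of smaller
    entries. *)
Lemma std_word_eq w s : perm_eq s (iota 1 (size w)) ->
  (forall p q, p < size w -> q < size w -> nth 0 w p < nth 0 w q -> nth 0 s p < nth 0 s q) ->
  (forall p q, p < q -> q < size w -> nth 0 w p = nth 0 w q -> nth 0 s p < nth 0 s q) ->
  std_word w = s.
Proof.
move=> pe h1 h2; have ss : size s = size w by rewrite (perm_size pe) size_iota.
apply: (@eq_from_nth _ 0); first by rewrite size_map size_iota.
rewrite size_map size_iota => p lp; rewrite (nth_map 0) ?size_iota // nth_iota // add0n.
have hp : 0 < nth 0 s p <= size w.
  have : nth 0 s p \in iota 1 (size w) by rewrite -(perm_mem pe) mem_nth // ss.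
  by rewrite mem_iota; clear; lia.
rewrite -[RHS](iota_count_lt hp) -(permP pe) [in RHS]count_nth ss; congr _.+1.
rewrite count_nth.
have -> : count (pred1 (nth 0 w p)) (take p w) =
    count (fun q => (q < p) && (nth 0 w q == nth 0 w p)) (iota 0 (size w)).
  rewrite -{1}(subnKC (ltnW lp)) iotaD count_cat add0n.
  rewrite [X in _ + X](_ : _ = 0) ?addn0; last first.
    apply/eqP; rewrite -leqn0 leqNgt -has_count; apply/hasPn => q.
    by rewrite mem_iota => /andP[l _]; rewrite ltnNge l.
  rewrite [LHS]count_nth size_takel ?(ltnW lp) //; apply: eq_in_count => q.
  by rewrite mem_iota add0n => /andP[_ l]; rewrite nth_take // l.
rewrite -count_predUI [X in _ + X](_ : _ = 0) ?addn0; last first.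
  apply/eqP; rewrite -leqn0 leqNgt -has_count; apply/hasPn => q _ /=.
  by apply/negP => /and3P[l _ /eqP e]; move: l; rewrite e ltnn.
apply: eq_in_count => q; rewrite mem_iota add0n => /andP[_ lq] /=.
case: (ltngtP (nth 0 w q) (nth 0 w p)) => [l|l|e] /=.
- by rewrite h1.
- by rewrite andbF; apply/esym/negbTE; rewrite -leqNgt; apply/ltnW/h1.
- rewrite andbT; case: (ltngtP q p) => [l|l|->]; last by rewrite ltnn.
  + by rewrite h2.
  + by apply/esym/negbTE; rewrite -leqNgt; apply/ltnW/h2.
Qed.

Definition shift (i m k v : nat) : nat :=
  if v == i + k then i + m + k else if i + k < v <= i + m + k then v.-1 else v.

Lemma shift_inj i m k : injective (shift i m k).
Proof. by move=> x y; rewrite /shift; do !case: ifP; lia. Qed.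

(** After the crystal operator there are [m] letters [i] and [m + 1] letters [i.+1]; this is the
    collapse of the new values along that division, one place lower than in [dyck_collapse]. *)
Definition collapse_after (i m x : nat) : nat :=
  if i <= x < i + m then i else if i + m <= x <= i + 2 * m then i.+1 else x.

Lemma collapse_after_eq i m x y : 0 < m -> collapse_after i m x = collapse_after i m y ->
  [\/ x = y, (i <= x < i + m) && (i <= y < i + m) |
    (i + m <= x <= i + 2 * m) && (i + m <= y <= i + 2 * m)].
Proof.
move=> m0; rewrite /collapse_after; case: (boolP (i <= x < i + m)) => hx; case: (boolP (i <= y < i + m)) => hy;
  case: (boolP (i + m <= x <= i + 2 * m)) => hx'; case: (boolP (i + m <= y <= i + 2 * m)) => hy' e;
  first [by constructor 2 | by constructor 3 | by constructor 1 | by exfalso; lia].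
Qed.

Lemma shift_low i m k v : k <= m -> i <= shift i m k v < i + m ->
  [/\ i <= v <= i + m, v <> i + k & shift i m k v = v - (i + k < v)].
Proof. by rewrite /shift => km; do !case: ifP; split; lia. Qed.

Lemma shift_high i m k v : k <= m -> i + m <= shift i m k v <= i + 2 * m ->
  v = i + k \/ i + m < v <= i + 2 * m.
Proof. by rewrite /shift => km; do !case: ifP; lia. Qed.

Section Edge.
Variables (N : nat) (pi : seq nat) (i m k : nat).
Hypotheses (up : uniq pi) (mp : forall v, (v \in pi) = (0 < v <= N)).
Hypotheses (m0 : 0 < m) (i0 : 0 < i) (iN : i + 2 * m <= N).
Let pos v := index v pi.
Hypotheses (dy : dyck_order pos i m) (sp : dyck_split pos i m k).

Let low := [pred v | i <= v <= i + m].
Let high := [pred v | i + m < v <= i + 2 * m].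

Lemma collapse_low v : (dyck_collapse i m v == i) = low v.
Proof. by rewrite /dyck_collapse /=; do 2?case: ifP; clear -m0; lia. Qed.

Lemma collapse_high v : (dyck_collapse i m v == i.+1) = high v.
Proof. by rewrite /dyck_collapse /=; do 2?case: ifP; clear -m0; lia. Qed.

Lemma count_collapse s : count (pred1 i) (map (dyck_collapse i m) s) = count low s /\
  count (pred1 i.+1) (map (dyck_collapse i m) s) = count high s.
Proof.
by rewrite !count_map; split; apply: eq_count => v; [apply: collapse_low | apply: collapse_high].
Qed.

Let p := pos (i + k).

Lemma letter_in v : low v || high v -> v \in pi.
Proof. by rewrite mp /=; clear -i0 iN; lia. Qed.

(** Left of the free letter, [split_before] provides for each closing bracket [v] the earlier
    opening bracket [v + m.+1], which therefore lies in the same prefix. *)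
Lemma balanced_before q : count low (take q (take p pi)) <= count high (take q (take p pi)).
Proof.
have ut : uniq (take q (take p pi)) by rewrite !take_uniq.
apply: (count_le_inj (f := fun v => v + m.+1)) => //; first by move=> x y _ _ /=; clear; lia.
have km := split_le sp.
have mt v : v \in pi -> (v \in take q (take p pi)) = (index v pi < minn q p).
  by move=> vp; rewrite -take_min in_take.
move=> v vt lv; have vp : v \in pi by apply: letter_in; rewrite lv.
move: vt; rewrite mt // => vt.
have vk : v < i + k by rewrite -(split_low dy sp) //; move: vt; rewrite -/(pos v) -/p; clear; lia.
have hv : high (v + m.+1) by move: lv; rewrite /=; clear -vk km; lia.
have vp' : v + m.+1 \in pi by apply: letter_in; rewrite hv orbT.
rewrite hv mt // andbT; apply: leq_trans vt; rewrite ltnS.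
have jk : v - i < k by move: lv; rewrite /=; clear -vk; lia.
have := split_before sp jk; rewrite /pos.
have -> : i + m + 1 + (v - i) = v + m.+1 by move: lv; rewrite /=; clear; lia.
have -> : i + (v - i) = v by move: lv; rewrite /=; clear; lia.
exact: ltnW.
Qed.

(** Right of the free letter the partner is [v + m], earlier than [v] by the ballot condition; that
    it still lies to the right of the free letter is [split_high]. *)
Lemma balanced_after q : count low (take q (drop p.+1 pi)) <= count high (take q (drop p.+1 pi)).
Proof.
have ut : uniq (take q (drop p.+1 pi)) by rewrite take_uniq // drop_uniq.
apply: (count_le_inj (f := fun v => v + m)) => //; first by move=> x y _ _ /=; clear; lia.
have km := split_le sp.
move=> v vt lv; have vp : v \in pi by apply: letter_in; rewrite lv.
move: vt; rewrite mem_take_drop // => /andP[v1 v2].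
have vk : i + k < v.
  have := split_low dy sp lv; rewrite -/p.
  have nv : v <> i + k by move=> e; move: v1; rewrite e -/(pos _) -/p; clear; lia.
  by move: v1; rewrite -/(pos v); clear -nv; lia.
have hv : high (v + m) by move: lv; rewrite /=; clear -vk km; lia.
have vp' : v + m \in pi by apply: letter_in; rewrite hv orbT.
rewrite hv mem_take_drop // andbT.
have jm : v - i - 1 < m by move: lv; rewrite /=; clear -vk; lia.
have := dyck_ballot dy jm; rewrite /pos.
have -> : i + m + 1 + (v - i - 1) = v + m by move: lv; rewrite /=; clear -vk; lia.
have -> : i + (v - i - 1) + 1 = v by move: lv; rewrite /=; clear -vk; lia.
move=> lt; rewrite (ltn_trans lt v2) andbT.
have : ~~ (pos (v + m) < p) by rewrite (split_high dy sp hv); clear -vk; lia.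
have : pos (v + m) <> p.
  have ik : i + k \in pi by apply: letter_in; rewrite /=; clear -km; lia.
  by move/(index_inj 0 vp' ik); move: lv; rewrite /=; clear -vk km; lia.
by rewrite /pos; clear; lia.
Qed.

(** Ensures that no open bracket is pending when the scan reaches [i+k], so that this letter is
    indeed free. *)
Lemma balanced_total : count high (take p pi) <= count low (take p pi).
Proof.
have ut : uniq (take p pi) by rewrite take_uniq.
apply: (count_le_inj (f := fun v => v - m.+1)) => //.
  by move=> x y; rewrite /high !inE /=; clear; lia.
have km := split_le sp.
move=> v vt hv; have vp : v \in pi by apply: letter_in; rewrite hv orbT.
move: vt; rewrite in_take // => vt.
have vk : v <= i + m + k by rewrite -(split_high dy sp).
have lv : low (v - m.+1) by move: hv; rewrite /=; clear -vk km; lia.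
have vp' : v - m.+1 \in pi by apply: letter_in; rewrite lv.
rewrite lv in_take // andbT -/(pos _) (split_low dy sp lv).
by move: hv; rewrite /=; clear -vk km m0; lia.
Qed.

Lemma p_lt : p < size pi.
Proof.
by rewrite index_mem; apply: letter_in; have km := split_le sp; rewrite /=; clear -km; lia.
Qed.

Lemma nth_p : nth 0 pi p = i + k.
Proof. by apply: nth_index; rewrite -index_mem; apply: p_lt. Qed.

Lemma crystal_f_collapse : crystal_f i (map (dyck_collapse i m) pi) =
  Some (set_nth 0 (map (dyck_collapse i m) pi) p i.+1).
Proof.
rewrite /crystal_f.
have e : pi = take p pi ++ (i + k) :: drop p.+1 pi.
  by rewrite -{1}nth_p -drop_nth ?cat_take_drop // p_lt.
rewrite {1}e map_cat /= rightmost_free_balanced; last first.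
  by move=> q; rewrite -map_take !(count_collapse _).1 !(count_collapse _).2; apply: balanced_before.
rewrite (count_collapse _).1 (count_collapse _).2.
have -> : count high (take p pi) - count low (take p pi) = 0.
  by apply/eqP; rewrite subn_eq0 balanced_total.
have ck : dyck_collapse i m (i + k) = i.
  by apply/eqP; rewrite collapse_low /=; have := split_le sp; clear; lia.
rewrite /= ck eqxx; have -> : (i == i.+1) = false by clear; lia.
rewrite -[map _ (drop _ _)]cats0 rightmost_free_balanced; last first.
  by move=> q; rewrite -map_take !(count_collapse _).1 !(count_collapse _).2; apply: balanced_after.
by rewrite /= size_map size_takel // ltnW // p_lt.
Qed.

Lemma perm_pi : perm_eq pi (iota 1 N).
Proof.
apply: uniq_perm => //; first exact: iota_uniq.
by move=> v; rewrite mp mem_iota; clear; lia.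
Qed.

Lemma std_crystal : std_word (set_nth 0 (map (dyck_collapse i m) pi) p i.+1) = map (shift i m k) pi.
Proof.
have km := split_le sp; have lp := p_lt.
set w := set_nth _ _ _ _.
have sw : size w = size pi by rewrite size_set_nth size_map; apply/maxn_idPr.
(* Each letter of the new word is the class of a shifted value. Since [collapse_after] is weakly
   monotone, distinct letters are already ordered correctly and only ties remain. *)
have wE q : q < size pi -> nth 0 w q = collapse_after i m (shift i m k (nth 0 pi q)).
  move=> lq; rewrite nth_set_nth /= (nth_map 0) //.
  have -> : (q == p) = (nth 0 pi q == i + k) by rewrite -nth_p nth_uniq.
  move: (nth 0 pi q) => v; rewrite /collapse_after /shift /dyck_collapse.
  by clear -km m0; do !case: ifP; lia.
have sE q : q < size pi -> nth 0 (map (shift i m k) pi) q = shift i m k (nth 0 pi q).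
  by move=> lq; rewrite (nth_map 0).
apply: std_word_eq.
- rewrite sw (perm_size perm_pi) size_iota; apply: uniq_perm; rewrite ?iota_uniq //.
    by rewrite map_inj_uniq //; apply: shift_inj.
  move=> x; rewrite mem_iota; apply/mapP/idP => [[v] | hx].
    by rewrite mp => hv ->; rewrite /shift; clear -hv km i0 iN; do !case: ifP; lia.
  exists (if x == i + m + k then i + k else if i + k <= x < i + m + k then x.+1 else x).
    by rewrite mp; clear -hx km i0 iN m0; do !case: ifP; lia.
  by rewrite /shift; clear -km m0; do !case: ifP; lia.
- rewrite sw => q r lq lr; rewrite !wE // !sE //.
  move: (shift _ _ _ _) (shift _ _ _ _) => x y; rewrite /collapse_after.
  by clear -m0; do !case: ifP; lia.
rewrite sw => q r qr lr; have lq : q < size pi by apply: ltn_trans lr.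
rewrite !wE // !sE //.
have : pos (nth 0 pi q) < pos (nth 0 pi r) by rewrite /pos !index_uniq.
move: (nth 0 pi q) (nth 0 pi r) => u v uv e.
have nuv : u <> v by move=> e'; move: uv; rewrite e' ltnn.
have ll : low u -> low v -> u < v.
  move=> hu hv; case: (ltngtP u v) => // h.
  have : pos v < pos u by apply: (dyck_low dy) => //; [case/andP: hv | case/andP: hu].
  by clear -uv; lia.
have hh : high u -> high v -> u < v.
  move=> hu hv; case: (ltngtP u v) => // h.
  have : pos v < pos u by apply: (dyck_high dy) => //; [case/andP: hv | case/andP: hu].
  by clear -uv; lia.
(* Among the letters [i.+1] the new one stands after the opening brackets up to [i+m+k] and before
   the others. The former shift down to [i+m..i+m+k-1], which leaves [i+m+k] for it. *)
have hk : high u -> v = i + k -> u <= i + m + k.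
  by move=> hu ev; rewrite -(split_high dy sp hu) -ev.
have kh : high v -> u = i + k -> i + m + k < v.
  move=> hv eu; have := split_high dy sp hv; rewrite -eu; move: uv; clear; lia.
case: (collapse_after_eq m0 e) => [/shift_inj //|/andP[eu ev]|/andP[eu ev]].
  have [lu nu su] := shift_low km eu; have [lv nv sv] := shift_low km ev.
  by have := ll lu lv; rewrite su sv; clear -nu nv; lia.
have {eu}eu := shift_high km eu; have {ev}ev := shift_high km ev; rewrite /shift.
case: eu => [eu|hu]; case: ev => [ev|hv].
- by case: nuv; rewrite eu ev.
- by have := kh hv eu; clear -km eu hv; do !case: ifP; lia.
- by have := hk hu ev; clear -km ev hu; do !case: ifP; lia.
- by have := hh hu hv; clear -km hu hv; do !case: ifP; lia.
Qed.

Lemma index_shift v : index (shift i m k v) (map (shift i m k) pi) = pos v.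
Proof. exact/index_map/shift_inj. Qed.
End Edge.

(** The fibres of the label [f] are a cover by [n] sets each of which meets a chain at most once. *)
Lemma chains_le_label (L : pred nat) (e : rel nat) (f : nat -> nat) n :
  (forall u v, L u -> L v -> e u v -> f u < f v) -> (forall v, L v -> f v < n) ->
  chains_le L e n.
Proof.
move=> h1 h2 s Ls so; rewrite -(size_map f); apply: size_bounded_ltn.
  by apply: (homo_sorted_in (P := L)) so.
by rewrite all_map; apply: sub_all Ls => v /h2.
Qed.

(** * Rectangles adjacent to a Dyck pattern interval *)

Section Rectangles.
Variables (N : nat) (pi : seq nat) (i m k : nat).
Hypotheses (mp : forall v, (v \in pi) = (0 < v <= N)).
Hypotheses (m0 : 0 < m) (i0 : 0 < i) (iN : i + 2 * m <= N).
Let pos v := index v pi.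
Hypotheses (dy : dyck_order pos i m) (sp : dyck_split pos i m k).

Lemma pos_neq u v : 0 < u <= N -> 0 < v <= N -> u <> v -> pos u <> pos v.
Proof. by move=> hu hv ne /(index_inj 0) e; apply: ne; apply: e; rewrite mp. Qed.

Lemma pos_nlt u v : 0 < u <= N -> 0 < v <= N -> u <> v -> ~~ (pos u < pos v) -> pos v < pos u.
Proof. by move=> hu hv ne; have := pos_neq hu hv ne; clear; lia. Qed.

Lemma last_open : pos (i + 2 * m) < pos (i + m).
Proof.
have j : m.-1 < m by rewrite prednK.
have := dyck_ballot dy j.
have -> : i + m + 1 + m.-1 = i + 2 * m by clear -m0; lia.
by have -> : i + m.-1 + 1 = i + m by clear -m0; lia.
Qed.

Lemma first_open : pos (i + m + 1) < pos (i + 1).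
Proof. by have := dyck_ballot dy m0; rewrite !addn0. Qed.

Let z := (i + 2 * m).+1.

(** Each failure yields a forbidden chain: [i..i+m, z] is increasing of length [m + 2] if [z]
    follows [i+m]; [z, i+2m, i+m] is decreasing if [z] precedes [i+2m]; and for [k < m] the word
    contains [i..i+k] followed by [i+m+1+k..z], again [m + 2] letters. *)
Lemma rectangle_right_config : z <= N ->
  chains_le (fun v => i <= v <= z) (val_inc pi) m.+1 ->
  chains_le (fun v => i <= v <= z) (val_dec pi) 2 ->
  [/\ k = m, pos (i + 2 * m) < pos z & pos z < pos (i + m)].
Proof.
move=> zN hi hd; have km := split_le sp.
have rg v : i <= v <= z -> 0 < v <= N by clear -i0 zN; lia.
have c1 : pos z < pos (i + m).
  apply: pos_nlt; [apply: rg; rewrite /z; clear; lia | apply: rg; rewrite /z; clear; lia | rewrite /z; clear -m0; lia |].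
  apply/negP => lt; have := hi (iota i m.+1 ++ iota z 1).
  rewrite size_cat !size_iota => H; have /H : all (fun v => i <= v <= z) (iota i m.+1 ++ iota z 1).
    by apply/allP => v; rewrite mem_cat !mem_iota /z; clear; lia.
  suff so : sorted (val_inc pi) (iota i m.+1 ++ iota z 1) by move/(_ so); clear; lia.
  apply: two_runs_sorted.
  - by move=> x y h1 h2 h3; apply: (dyck_low dy) => //; clear -h3; lia.
  - by move=> x y; clear; lia.
  - by move=> _ _; split; [rewrite /z; clear; lia | rewrite addnS].
have c2 : pos (i + 2 * m) < pos z.
  apply: pos_nlt; [apply: rg; rewrite /z; clear; lia | apply: rg; rewrite /z; clear; lia | rewrite /z; clear; lia |].
  apply/negP => lt; have := hd [:: i + m; i + 2 * m; z]; rewrite /= /val_dec -!/(pos _).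
  by rewrite last_open lt /z; clear -m0; lia.
split=> //; apply/eqP; rewrite eqn_leq km leqNgt; apply/negP => lkm.
have := hi (iota i k.+1 ++ iota (i + m + 1 + k) (m - k).+1).
rewrite size_cat !size_iota => H.
have /H : all (fun v => i <= v <= z) (iota i k.+1 ++ iota (i + m + 1 + k) (m - k).+1).
  by apply/allP => v; rewrite mem_cat !mem_iota /z; clear -lkm; lia.
suff so : sorted (val_inc pi) (iota i k.+1 ++ iota (i + m + 1 + k) (m - k).+1).
  by move/(_ so); clear -lkm; lia.
apply: two_runs_sorted.
- by move=> x y h1 h2 h3; apply: (dyck_low dy) => //; clear -h3 lkm; lia.
- move=> x y h1 h2 h3; case: (y =P z) => [->|ne]; last first.
    by apply: (dyck_high dy) => //; move: ne; rewrite /z; clear -h1 h3 lkm; lia.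
  case: (x =P i + 2 * m) => [->//|ne]; apply: ltn_trans c2.
  by apply: (dyck_high dy); move: ne; clear -h1 h2 h3 lkm; lia.
- move=> _ _; split; first by clear -lkm; lia.
  by rewrite addnS /=; apply: split_after sp lkm.
Qed.

Lemma config_rectangle_right : z <= N -> k = m ->
  pos (i + 2 * m) < pos z -> pos z < pos (i + m) ->
  chains_le (fun v => i <= v <= z) (val_inc pi) m.+1 /\
  chains_le (fun v => i <= v <= z) (val_dec pi) 2.
Proof.
move=> zN ekm c1 c2.
have high x y : i + m < x -> x < y -> y <= z -> pos x < pos y.
  move=> h1 h2 h3; case: (y =P z) => [->|ne]; last first.
    by apply: (dyck_high dy) => //; move: ne; rewrite /z; clear -h3; lia.
  case: (x =P i + 2 * m) => [->//|ne]; apply: ltn_trans c1.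
  by apply: (dyck_high dy) => //; move: ne h2 h3; rewrite /z; clear; lia.
split.
  (* The label pairs each closing bracket [v] with the opening bracket [v + m.+1], which precedes it
     because [k = m]; [z] is the partner of [i + m]. This makes [m + 1] labels. *)
  apply: (@chains_le_label _ _ (fun v => if v <= i + m then v - i else v - (i + m + 1))).
    move=> u v hu hv /andP[uv puv].
    case: (leqP u (i + m)) => lu; case: (leqP v (i + m)) => lv; try by clear -uv hu lu lv; lia.
    rewrite ltnNge; apply/negP => le.
    have b : pos (u + m.+1) < pos u.
      case: (u =P i + m) => [e|ne].
        by rewrite e; have -> : i + m + m.+1 = z by rewrite /z; clear; lia.
      have jk : u - i < k by rewrite ekm; clear -ne lu hu m0; lia.
      have := split_before sp jk.
      have -> : i + m + 1 + (u - i) = u + m.+1 by clear -hu; lia.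
      by have -> : i + (u - i) = u by clear -hu; lia.
    have : pos v <= pos (u + m.+1); last by move: puv; rewrite -!/(pos _); clear -b; lia.
    case: (v =P u + m.+1) => [->//|ne]; apply/ltnW/high => //; rewrite /z; clear -ne le lv lu hu; lia.
  by move=> v; rewrite /z; case: ifP; clear; lia.
(* [z] prolongs the run of opening brackets, so the letters split into two increasing runs. *)
apply: (@chains_le_label _ _ (fun v => (i + m < v) : nat)).
  move=> u v hu hv /andP[uv]; rewrite -!/(pos _) => puv.
  case: (leqP u (i + m)) => lu; case: (leqP v (i + m)) => lv //.
  - have : pos u < pos v by apply: (dyck_low dy) => //; case/andP: hu.
    by clear -puv; lia.
  - by clear -lu lv uv; lia.
  - have : pos u < pos v by apply: high => //; case/andP: hv.
    by clear -puv; lia.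
by move=> v _; case: (i + m < v).
Qed.

Let y := i.-1.

(** The forbidden chains are [y, i..i+m], increasing of length [m + 2], if [y] precedes [i]; the
    decreasing [i+m+1, i, y] if [k > 0]; and the decreasing [i+m+1, i+1, y] if [y] follows [i+1]. *)
Lemma rectangle_left_config : 0 < y ->
  chains_le (fun v => y <= v <= i + 2 * m) (val_inc pi) m.+1 ->
  chains_le (fun v => y <= v <= i + 2 * m) (val_dec pi) 2 ->
  [/\ k = 0, pos i < pos y & pos y < pos (i + 1)].
Proof.
move=> y0 hi hd; have km := split_le sp; have ey : y.+1 = i by rewrite /y prednK.
have rg v : y <= v <= i + 2 * m -> 0 < v <= N by clear -y0 iN; lia.
have c1 : pos i < pos y.
  apply: pos_nlt; [apply: rg; clear -ey; lia | apply: rg; clear -ey; lia | clear -ey; lia |].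
  apply/negP => lt; have := hi (iota y 1 ++ iota i m.+1).
  rewrite size_cat !size_iota => H; have /H : all (fun v => y <= v <= i + 2 * m) (iota y 1 ++ iota i m.+1).
    by apply/allP => v; rewrite mem_cat !mem_iota; clear -ey; lia.
  suff so : sorted (val_inc pi) (iota y 1 ++ iota i m.+1) by move/(_ so); clear; lia.
  apply: two_runs_sorted.
  - by move=> x v; clear; lia.
  - by move=> x v h1 h2 h3; apply: (dyck_low dy) => //; clear -h3; lia.
  - by move=> _ _; split; [clear -ey; lia | rewrite addn1].
split=> //.
  apply/eqP; rewrite -leqn0 leqNgt; apply/negP => k0.
  have := split_before sp k0; rewrite !addn0 => lt.
  have := hd [:: y; i; i + m + 1]; rewrite /= /val_dec -!/(pos _) lt c1.
  by clear -ey m0; lia.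
apply: pos_nlt; [apply: rg; clear -ey m0; lia | apply: rg; clear -ey m0; lia | clear -ey; lia |].
apply/negP => lt.
have := hd [:: y; i + 1; i + m + 1]; rewrite /= /val_dec -!/(pos _) lt first_open.
by clear -ey m0; lia.
Qed.

Lemma config_rectangle_left : 0 < y -> k = 0 ->
  pos i < pos y -> pos y < pos (i + 1) ->
  chains_le (fun v => y <= v <= i + 2 * m) (val_inc pi) m.+1 /\
  chains_le (fun v => y <= v <= i + 2 * m) (val_dec pi) 2.
Proof.
move=> y0 ek c1 c2; have ey : y.+1 = i by rewrite /y prednK.
have ylow v : i < v -> v <= i + m -> pos y < pos v.
  move=> h1 h2; apply: leq_trans c2 _; case: (i + 1 =P v) => [->//|ne].
  by apply/ltnW/(dyck_low dy) => //; clear -ne h1; lia.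
have ihigh v : i + m < v -> v <= i + 2 * m -> pos i < pos v.
  move=> h1 h2; have hv : i + m < v <= i + 2 * m by rewrite h1.
  have := split_high dy sp hv; rewrite ek !addn0.
  have : pos i <> pos v by apply: pos_neq; clear -h1 h2 i0 iN; lia.
  by clear -h1; lia.
split.
  (* Now [v] is paired with [v + m], which precedes it by the ballot condition. Truncated
     subtraction gives [y] and [i] the common label 0, and [i] precedes [y]. *)
  apply: (@chains_le_label _ _ (fun v => if v <= i + m then v - i else v - (i + m))).
    move=> u v hu hv /andP[uv]; rewrite -!/(pos _) => puv.
    case: (leqP u (i + m)) => lu; case: (leqP v (i + m)) => lv; last by clear -uv lu lv; lia.
    - case: (v =P i) => [e|ne]; last by clear -uv ne hu hv ey; lia.
      have e2 : u = y by clear -uv e hu ey; lia.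
      by move: puv c1; rewrite e e2; clear; lia.
    - rewrite ltnNge; apply/negP => le.
      have jm : u - i - 1 < m by clear -lu le lv; lia.
      have := dyck_ballot dy jm.
      have -> : i + m + 1 + (u - i - 1) = u + m by clear -le lv; lia.
      have -> : i + (u - i - 1) + 1 = u by clear -le lv; lia.
      have : pos v <= pos (u + m); last by clear -puv; lia.
      case: (v =P u + m) => [->//|ne]; apply/ltnW/(dyck_high dy) => //; clear -ne le lv lu; lia.
    - by clear -uv lu lv; lia.
  by move=> v; case: ifP; clear -ey m0; lia.
(* The two increasing runs are [y, i+1..i+m] and [i, i+m+1..i+2m]: [y] takes the place of [i], which
   is free for [k = 0] and precedes all opening brackets. *)
apply: (@chains_le_label _ _ (fun v => ((v == i) || (i + m < v)) : nat)); last first.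
  by move=> v _; case: (_ || _).
move=> u v hu hv /andP[uv]; rewrite -!/(pos _) => puv.
have nlt : pos u < pos v -> False by clear -puv; lia.
case: (leqP u (i + m)) => lu; last first.
  by case: nlt; apply: (dyck_high dy) => //; case/andP: hv.
case: (leqP v (i + m)) => lv; last first.
  case: (u =P i) => [e|ne]; last by rewrite orbT.
  by case: nlt; rewrite e; apply: ihigh => //; case/andP: hv.
case: (u =P y) => [e|ne]; last first.
  by case: nlt; apply: (dyck_low dy) => //; clear -ne hu ey; lia.
case: (v =P i) => [_|nv]; first by rewrite e; clear -ey; lia.
by case: nlt; rewrite e; apply: ylow => //; clear -hv nv e uv ey; lia.
Qed.
End Rectangles.

(** * Descents and blocks *)

(** The interval is open on the left, so that consecutive descents are exactly the two ends of a
    block. *)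
Definition ivl (a b : nat) : seq nat := iota a.+1 (b - a).

Lemma sumn_take_gaps x D p : path leq x D -> p <= size D ->
  sumn (take p (pairmap (fun a b => b - a) x D)) + x = nth 0 (x :: D) p.
Proof.
elim: D x p => [|d D IH] x [|p] //= /andP[xd pa] lp.
by have := IH d p pa lp; rewrite /=; clear -xd; lia.
Qed.

Lemma blocks_gaps D : path leq 0 D ->
  blocks (pairmap (fun a b => b - a) 0 D) = pairmap ivl 0 D.
Proof.
move=> pa; have sz : size (pairmap (fun a b => b - a) 0 D) = size D := size_pairmap _ _ _.
apply: (@eq_from_nth _ [::]); first by rewrite size_map size_iota sz size_pairmap.
rewrite size_map size_iota sz => p lp.
rewrite (nth_map 0) ?size_iota ?sz // nth_iota ?sz // add1n /blk sz lp /=.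
rewrite (nth_pairmap 0) // (nth_pairmap 0) //.
by have := sumn_take_gaps pa (ltnW lp); rewrite addn0 => ->.
Qed.

Lemma blk_nth alpha j : 0 < j -> blk alpha j = nth [::] (blocks alpha) j.-1.
Proof.
case: j => // j _; rewrite /blocks; case: (ltnP j (size alpha)) => h.
  by rewrite (nth_map 0) ?size_iota // nth_iota // add1n.
by rewrite nth_default ?size_map ?size_iota // /blk /= ltnNge h.
Qed.

Lemma blk_run alpha p n : p + n <= size alpha ->
  [seq blk alpha k | k <- iota p.+1 n] = take n (drop p (blocks alpha)).
Proof.
move=> h; rewrite /blocks -map_drop drop_iota -map_take take_iota add1n.
by congr (map _ (iota _ _)); clear -h; lia.
Qed.

Lemma sunion_iota A B p n : (forall x, (x \in A) || (x \in B) = (p <= x < p + n)) ->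
  sunion A B = iota p n.
Proof.
move=> h; apply: (sorted_eq leq_trans anti_leq).
- exact: (sort_sorted leq_total).
- exact: iota_sorted.
- rewrite perm_sort; apply: uniq_perm; rewrite ?undup_uniq ?iota_uniq //.
  by move=> x; rewrite mem_undup mem_cat mem_iota h.
Qed.

Lemma sminus_iota A B p n : sorted ltn A ->
  (forall x, (x \in A) && (x \notin B) = (p <= x < p + n)) -> sminus A B = iota p n.
Proof.
move=> so h; apply: (irr_sorted_eq ltn_trans ltnn).
- exact: (sorted_filter ltn_trans).
- exact: iota_ltn_sorted.
- by move=> x; rewrite mem_filter mem_iota andbC h.
Qed.

Lemma mem_descents N T d : standard N T ->
  (d \in descents N T) = (0 < d < N) && (index d.+1 (row_word T) < index d (row_word T)).
Proof.
move=> sT; rewrite mem_filter mem_iota andbC.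
have -> : (0 < d < 1 + N.-1) = (0 < d < N) by clear; lia.
case: (boolP (0 < d < N)) => //= h; rewrite (pi_index_gt sT) //; clear -h; lia.
Qed.

Lemma sorted_descents N T : sorted ltn (descents N T).
Proof. exact/(sorted_filter ltn_trans)/iota_ltn_sorted. Qed.

Lemma blocks_Des N T : blocks (Des N T) = pairmap ivl 0 (rcons (descents N T) N).
Proof.
apply: blocks_gaps; rewrite rcons_path; apply/andP; split.
  rewrite path_sortedE; last exact: leq_trans.
  by apply/andP; split; [apply/allP | apply: (sub_sorted ltnW); apply: sorted_descents].
have := mem_last 0 (descents N T); move: (last _ _) => x.
rewrite inE => /orP[/eqP->//|].
by rewrite mem_filter mem_iota => /and3P[_ h1 h2]; clear -h1 h2; lia.
Qed.

Lemma size_Des N T : size (Des N T) = size (blocks (Des N T)).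
Proof. by rewrite size_map size_iota. Qed.

(** * Descents before and after the edge *)

Definition unshift (i m k x : nat) : nat :=
  if x == i + m + k then i + k else if i + k <= x < i + m + k then x.+1 else x.

Lemma unshiftK i m k x : shift i m k (unshift i m k x) = x.
Proof. by rewrite /shift /unshift; do !case: ifP; lia. Qed.

Section Descents.
Variables (N : nat) (pi : seq nat) (i m k : nat).
Hypotheses (up : uniq pi) (mp : forall v, (v \in pi) = (0 < v <= N)).
Hypotheses (m0 : 0 < m) (i0 : 0 < i) (iN : i + 2 * m <= N).
Let pos v := index v pi.
Hypotheses (dy : dyck_order pos i m) (sp : dyck_split pos i m k).
Let pos' v := index v (map (shift i m k) pi).

Lemma pos_unshift x : pos' x = pos (unshift i m k x).
Proof. by rewrite /pos' -{1}(unshiftK i m k x) index_shift. Qed.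

Lemma desc_inside d : i <= d < i + 2 * m -> (pos d.+1 < pos d) = (d == i + m).
Proof.
move=> h; case: (ltngtP d (i + m)) => [l|l|->].
- have : pos d < pos d.+1 by apply: (dyck_low dy); clear -h l; lia.
  by clear; lia.
- have : pos d < pos d.+1 by apply: (dyck_high dy); clear -h l; lia.
  by clear; lia.
have : pos (i + 1) <= pos (i + m).
  case: (i + 1 =P i + m) => [->//|ne]; apply/ltnW/(dyck_low dy); clear -ne m0; lia.
have f : pos (i + m + 1) < pos (i + 1) := first_open m0 dy.
by rewrite addn1 in f; clear -f; lia.
Qed.

Lemma desc'_low d : i <= d -> d.+1 < i + m -> pos' d < pos' d.+1.
Proof.
have km := split_le sp.
by move=> h1 h2; rewrite !pos_unshift; apply: (dyck_low dy); rewrite /unshift;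
  clear -h1 h2 km; do !case: ifP; lia.
Qed.

(** For [k = 0] the two values occupy the old places of [i] and [i + m]. For [k > 0] the value
    [i + m] sits at the first opening bracket, which precedes every closing bracket by
    [split_before]. *)
Lemma desc'_mid : pos' (i + m) < pos' (i + m).-1.
Proof.
have km := split_le sp; rewrite !pos_unshift.
case: (posnP k) => [k0|k0].
  have -> : unshift i m k (i + m) = i by rewrite /unshift; clear -k0; do !case: ifP; lia.
  have -> : unshift i m k (i + m).-1 = i + m.
    by rewrite /unshift; clear -k0 m0; do !case: ifP; lia.
  by apply: (dyck_low dy); clear -m0; lia.
have -> : unshift i m k (i + m) = i + m + 1.
  by rewrite /unshift; clear -k0 km; do !case: ifP; lia.
have h1 := split_before sp k0; rewrite !addn0 in h1.
apply: leq_trans h1 _.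
have : i <= unshift i m k (i + m).-1 <= i + m.
  by rewrite /unshift; clear -k0 m0 km; do !case: ifP; lia.
move: (unshift _ _ _ _) => v hv; case: (i =P v) => [->//|ne].
by apply/ltnW/(dyck_low dy); clear -hv ne; lia.
Qed.

(** The values from [i+m] on sit at the opening brackets with the free letter inserted as [i+m+k].
    Only its two neighbours need care; there [split_high] and [split_after] apply. *)
Lemma desc'_high d : i + m <= d -> d < i + 2 * m -> pos' d < pos' d.+1.
Proof.
have km := split_le sp; move=> h1 h2; rewrite !pos_unshift.
case: (d =P i + m + k) => [e|n1].
  have kl : k < m by clear -e h2; lia.
  have -> : unshift i m k d = i + k by rewrite /unshift e eqxx.
  have -> : unshift i m k d.+1 = i + m + 1 + k.
    by rewrite /unshift e; clear; do !case: ifP; lia.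
  exact: split_after sp kl.
case: (d.+1 =P i + m + k) => [e|n2].
  have -> : unshift i m k d.+1 = i + k by rewrite /unshift e eqxx.
  have -> : unshift i m k d = i + m + k.
    by rewrite /unshift; clear -e h1 km; do !case: ifP; lia.
  by rewrite (split_high dy sp) //; clear -e h1 h2; lia.
by apply: (dyck_high dy); rewrite /unshift; clear -h1 h2 km n1 n2; do !case: ifP; lia.
Qed.

Lemma desc'_inside d : i <= d < i + 2 * m -> (pos' d.+1 < pos' d) = (d == (i + m).-1).
Proof.
move=> h; case: (ltngtP d (i + m).-1) => [l|l|->].
- have : pos' d < pos' d.+1 by apply: desc'_low; clear -h l; lia.
  by clear; lia.
- have : pos' d < pos' d.+1 by apply: desc'_high; clear -h l; lia.
  by clear; lia.
- by rewrite prednK ?desc'_mid // ltn_addr.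
Qed.

Lemma desc'_outside d : (d.+1 < i) || (i + 2 * m < d) -> (pos' d.+1 < pos' d) = (pos d.+1 < pos d).
Proof.
have km := split_le sp.
move=> h; rewrite !pos_unshift.
have -> : unshift i m k d = d by rewrite /unshift; clear -h km; do !case: ifP; lia.
by have -> : unshift i m k d.+1 = d.+1 by rewrite /unshift; clear -h km; do !case: ifP; lia.
Qed.

Definition right_config :=
  [&& k == m, pos (i + 2 * m) < pos (i + 2 * m).+1 & pos (i + 2 * m).+1 < pos (i + m)].
Definition left_config :=
  [&& k == 0, pos i < pos i.-1 & pos i.-1 < pos (i + 1)].

(** The place of the value [i] changes only for [k = 0], when it moves to the later place of
    [i + 1]; the descent is lost when [i.-1] stands in between. *)
Lemma desc'_left : 1 < i -> (pos' i < pos' i.-1) = (pos i < pos i.-1) && ~~ left_config.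
Proof.
move=> i1; have km := split_le sp; rewrite !pos_unshift /left_config.
have -> : unshift i m k i.-1 = i.-1 by rewrite /unshift; clear -i1 km; do !case: ifP; lia.
case: (k =P 0) => [k0|k0] /=; last first.
  by rewrite andbT; have -> : unshift i m k i = i by rewrite /unshift; clear -k0; do !case: ifP; lia.
have -> : unshift i m k i = i + 1 by rewrite /unshift; clear -m0 k0; do !case: ifP; lia.
have ne : pos i.-1 <> pos (i + 1) by apply: (pos_neq mp); clear -i1 m0 iN; lia.
have : pos i < pos (i + 1) by apply: (dyck_low dy); clear -m0; lia.
by clear -ne; lia.
Qed.

(** The place of the value [i + 2 * m] changes only for [k = m], when it moves to the later place of
    [i + m]; a descent is gained when the next value stands in between. *)
Lemma desc'_right : i + 2 * m < N ->
  (pos' (i + 2 * m).+1 < pos' (i + 2 * m)) = (pos (i + 2 * m).+1 < pos (i + 2 * m)) || right_config.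
Proof.
move=> i1; have km := split_le sp; rewrite !pos_unshift /right_config.
have -> : unshift i m k (i + 2 * m).+1 = (i + 2 * m).+1.
  by rewrite /unshift; clear -km; do !case: ifP; lia.
case: (k =P m) => [k0|k0] /=; last first.
  by rewrite orbF; have -> : unshift i m k (i + 2 * m) = i + 2 * m
    by rewrite /unshift; clear -k0 km; do !case: ifP; lia.
have -> : unshift i m k (i + 2 * m) = i + m by rewrite /unshift; clear -m0 k0; do !case: ifP; lia.
have ne : pos (i + 2 * m).+1 <> pos (i + 2 * m) by apply: (pos_neq mp); clear -i1 i0; lia.
have f : pos (i + 2 * m) < pos (i + m) := last_open m0 dy.
by clear -ne f; lia.
Qed.

Lemma right_left_config : right_config -> left_config -> False.
Proof. by move=> /and3P[/eqP h1 _ _] /and3P[/eqP h2 _ _]; clear -h1 h2 m0; lia. Qed.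
End Descents.

(** * Changing the list of blocks near one descent *)

Lemma block_index X c W j : sorted ltn (X ++ c :: W) ->
  c \in nth [::] (pairmap ivl 0 (X ++ c :: W)) j -> j = size X.
Proof.
set D := X ++ c :: W => so cj.
have lj : j < size D.
  rewrite -(size_pairmap ivl 0) ltnNge; apply/negP => h.
  by move: cj; rewrite nth_default.
have lq : size X < size D by rewrite size_cat /= addnS ltnS leq_addr.
have eq : nth 0 D (size X) = c by rewrite nth_cat ltnn subnn.
move: cj; rewrite (nth_pairmap 0) // mem_iota => /andP[h1 h2].
case: (ltngtP j (size X)) => // l.
  have : nth 0 D j < nth 0 D (size X) by apply: (sorted_ltn_nth ltn_trans 0 so).
  by rewrite eq; clear -h1 h2; lia.
case: j l lj h1 h2 => // j l lj h1 h2.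
have : nth 0 D (size X) <= nth 0 D j.
  apply: (sorted_leq_nth leq_trans leqnn); rewrite // ?inE //.
  - by apply: (sub_sorted ltnW).
  - exact: ltnW.
by rewrite eq; move: h1; rewrite /=; clear; lia.
Qed.

Section Update.
Variables (alpha X : seq nat) (c y : nat) (Z : seq nat) (j : nat).
Hypothesis BL : blocks alpha = pairmap ivl 0 (X ++ [:: c, y & Z]).
Hypothesis so : path ltn 0 (X ++ [:: c, y & Z]).
Hypothesis ej : j = (size X).+1.
Let a := last 0 X.

Lemma blocks_split : blocks alpha =
  pairmap ivl 0 X ++ [:: ivl a c, ivl c y & pairmap ivl y Z].
Proof. by rewrite BL pairmap_cat. Qed.

Lemma size_alpha : size alpha = size X + (size Z).+2.
Proof.
rewrite -(size_iota 1 (size alpha)) -(size_map (blk alpha)) -/(blocks alpha) BL.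
by rewrite size_pairmap size_cat.
Qed.

Lemma blk_cur : blk alpha j = ivl a c.
Proof.
by rewrite blk_nth ej //= blocks_split nth_cat size_pairmap ltnn subnn.
Qed.

Lemma blk_next : blk alpha j.+1 = ivl c y.
Proof.
by rewrite blk_nth ej //= blocks_split nth_cat size_pairmap ltnNge leqnSn /= subSnn.
Qed.

Lemma blocks_tail : [seq blk alpha k | k <- iota j.+2 (size alpha - j.+1)] = pairmap ivl y Z.
Proof.
rewrite blk_run; last by rewrite subnKC // size_alpha ej; clear; lia.
rewrite take_oversize; last by rewrite size_drop size_map size_iota.
rewrite blocks_split ej drop_cat size_pairmap.
have -> : ((size X).+2 < size X) = false by clear; lia.
have -> : (size X).+2 - size X = 2 by clear; lia.
by rewrite /= drop0.
Qed.

(** For [j = 1] the list is empty and [blk alpha 0] is removed as an empty block; for larger [j] the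
    block before the current one is non-empty and kept. So the same formula covers both. *)
Lemma blocks_head S : [seq blk alpha k | k <- iota 1 (j - 2)] ++
    [seq s <- blk alpha j.-1 :: S | size s != 0] =
  pairmap ivl 0 X ++ [seq s <- S | size s != 0].
Proof.
rewrite blk_run; last by rewrite size_alpha ej; clear; lia.
rewrite drop0 ej [(size X).+1.-1]/=; have := so; have := blocks_split.
case/lastP: X => [|X' x] bs pa; first by rewrite take0.
have lx : last 0 X' < x.
  by move: pa; rewrite cat_path rcons_path => /andP[/andP[]].
rewrite size_rcons subSS subn1 /= blk_nth // bs.
rewrite -[rcons X' x]cats1 pairmap_cat -!catA take_size_cat ?size_pairmap // nth_cat size_pairmap ltnn subnn /=.
by rewrite /ivl size_iota subn_eq0 -ltnNge lx.
Qed.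

(** Exposes the preceding block, which gets enlarged when the edge decreases the length. *)
Lemma blocks_head2 X' x : X = rcons X' x ->
  [seq blk alpha k | k <- iota 1 (j - 2)] = pairmap ivl 0 X' /\
  blk alpha j.-1 = ivl (last 0 X') x.
Proof.
move=> eX; rewrite blk_run; last by rewrite size_alpha ej; clear; lia.
rewrite drop0 ej eX size_rcons subSS subn1 /= blk_nth // blocks_split eX.
rewrite -[rcons X' x]cats1 pairmap_cat -!catA take_size_cat ?size_pairmap //.
by rewrite nth_cat size_pairmap ltnn subnn.
Qed.
End Update.

Lemma size_ivl a b : (size (ivl a b) != 0) = (a < b).
Proof. by rewrite size_iota subn_eq0 -ltnNge. Qed.

Lemma sorted_ltn_cat (X W : seq nat) : sorted ltn (X ++ W) <->
  [/\ sorted ltn X, sorted ltn W & forall x v, x \in X -> v \in W -> x < v].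
Proof.
rewrite !(sorted_pairwise ltn_trans) pairwise_cat; split.
  by case/and3P=> /allrelP h1 -> ->; split=> // x v hx hv; apply: h1.
by case=> -> -> h; rewrite !andbT; apply/allrelP.
Qed.

(** * The descent set of the target and the three cases *)

Section Transition.
Variables (la : seq nat) (T T' : tableau) (i m : nat).
Hypotheses (syt : is_SYT la T) (syt' : is_SYT la T') (edge : cs_edge la T i m T').
Let N := sumn la.
Let c := i + m.

Lemma transition : exists RC LC : bool,
  [/\ [/\ 0 < m, 0 < i & i + 2 * m <= N],
      has_rectangle N T i (i + 2 * m).+1 = RC /\
      has_rectangle N T i.-1 (i + 2 * m) = LC,
      (RC -> i + 2 * m < N) /\ (LC -> i.-1 \in descents N T) /\
      (RC -> i + 2 * m \notin descents N T) /\ ~~ (RC && LC),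
      (forall d, i <= d < i + 2 * m -> (d \in descents N T) = (d == c)) &
      forall d, (d \in descents N T') =
        [|| d == c.-1, (d == i + 2 * m) && RC
          | [&& d != c, d \in descents N T & ~~ ((d == i.-1) && LC)]]].
Proof.
have sT := is_SYT_standard syt; have sT' := is_SYT_standard syt'.
case: edge => dk [w' [cf eT]].
have up := pi_uniq sT; have mp := mem_pi sT; rewrite -/N in sT sT' mp dk.
case/and4P: (dk) => m0 i0 iN _.
set pi := row_word T in up mp dk cf.
have dy : dyck_order (index^~ pi) i m.
  by apply: (dyck_interval_order (N := N)) => // v hv; rewrite mp.
have [k sp] : exists k, dyck_split (index^~ pi) i m k.
  apply: dyck_split_exists => x y hx hy /(index_inj 0); apply.
    by rewrite mp; clear -hx i0 iN; lia.
  by rewrite mp; clear -hy i0 iN; lia.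
(* Cutting a word of the right length into rows and reading it again gives the word back, so the
   reading word of [T'] is the standardized word itself. *)
have pi' : row_word T' = map (shift i m k) pi.
  move: cf; rewrite (crystal_f_collapse up mp m0 i0 iN dy sp) => -[ew].
  have sw : std_word w' = map (shift i m k) pi by rewrite -ew; apply: (std_crystal up mp).
  rewrite eT sw /row_word /tab_of_row revK reshapeKr // size_map sumn_rev.
  by rewrite (perm_size (perm_row_word T)) (perm_size (std_perm sT)) size_iota.
have mD d := mem_descents d sT; rewrite -/pi in mD.
have mD' d := mem_descents d sT'; rewrite pi' in mD'.
pose z := (i + 2 * m).+1.
have hR : has_rectangle N T i z = (z <= N) && right_config pi i m k.
  apply/idP/idP.
    move/(has_rectangleP sT (n := m.+1)) => [||_ zN hi hd]; try by rewrite /z; clear; lia.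
    have [e1 e2 e3] := rectangle_right_config mp m0 i0 dy sp zN hi hd.
    by rewrite zN /right_config e1 eqxx e2 e3.
  case/and3P=> zN /eqP e1 /andP[e2 e3].
  apply/(has_rectangleP sT (n := m.+1)); try by rewrite /z; clear; lia.
  have [h1 h2] := config_rectangle_right m0 dy sp zN e1 e2 e3.
  by split.
have hL : has_rectangle N T i.-1 (i + 2 * m) = (0 < i.-1) && left_config pi i k.
  apply/idP/idP.
    move/(has_rectangleP sT (n := m.+1)) => [||y0 _ hi hd]; try by clear -i0; lia.
    have [e1 e2 e3] := rectangle_left_config mp m0 i0 iN dy sp y0 hi hd.
    by rewrite y0 /left_config e1 eqxx e2 e3.
  case/and3P=> y0 /eqP e1 /andP[e2 e3].
  apply/(has_rectangleP sT (n := m.+1)); try by clear -i0; lia.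
  have [h1 h2] := config_rectangle_left mp m0 i0 iN dy sp y0 e1 e2 e3.
  by split.
exists ((z <= N) && right_config pi i m k), ((0 < i.-1) && left_config pi i k).
have di d (h : i <= d < i + 2 * m) := desc_inside m0 dy h.
have ei : 0 < i.-1 -> i.-1.+1 = i by clear; lia.
split=> //.
- split; first by case/andP.
  split; last split.
  + case/andP=> y0 /and3P[_ h _]; rewrite mD ei // h andbT; clear -y0 iN; lia.
  + case/andP=> zN /and3P[_ h _]; rewrite mD negb_and; apply/orP; right.
    by rewrite -leqNgt ltnW.
  + by apply/negP => /andP[/andP[_ h1] /andP[_ h2]]; exact: right_left_config m0 h1 h2.
- move=> d h; rewrite mD (di d h) andb_idl // => /eqP ->; rewrite /c.
  by clear -i0 m0 iN; lia.
move=> d; rewrite mD' mD.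
(* Away from the interval nothing changes and inside it both descent sets are known; the two
   boundary values [i + 2 * m] and [i.-1] remain. *)
case: (boolP ((d.+1 < i) || (i + 2 * m < d))) => [out|nout].
  rewrite (desc'_outside sp out).
  move: (index d.+1 pi < _) (_ && right_config _ _ _ _) (_ && left_config _ _ _) => P RC LC.
  by rewrite /c; clear -out m0; lia.
case: (boolP (i <= d < i + 2 * m)) => [h|nin].
  rewrite (desc'_inside m0 i0 dy sp h) di // -/c.
  move: (_ && right_config _ _ _ _) (_ && left_config _ _ _) => RC LC.
  by rewrite /c; clear -h i0 m0 iN; lia.
case: (d =P i + 2 * m) => [->|n2].
  move: (_ && left_config _ _ _) => LC.
  have [zN|zN] : z <= N \/ N < z by clear; lia.
    have h1 : (0 < i + 2 * m < N) by move: zN; rewrite /z; clear -i0; lia.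
    have h2 : i + 2 * m < N by case/andP: h1.
    rewrite h1 (desc'_right mp m0 i0 dy sp h2) zN.
    move: (index _.+1 pi < _) (right_config _ _ _ _) => P RC.
    by rewrite /c; clear -m0 i0; lia.
  have h1 : (0 < i + 2 * m < N) = false by move: zN; rewrite /z; clear; lia.
  have h2 : (z <= N) = false by clear -zN; lia.
  by rewrite h1 h2 /c; clear -m0; lia.
have e : d = i.-1 by move: nout nin n2; clear; lia.
(* For [i = 1] the left boundary value is 0, a descent of neither tableau. *)
case: (posnP d) => [d0|d0].
  by rewrite d0 /c; clear -i0 m0; lia.
have e1 : d.+1 = i by rewrite e ei // -e.
have i1 : 1 < i by rewrite -e1.
rewrite e1 e (desc'_left mp m0 iN dy sp i1).
move: (_ && right_config _ _ _ _) (index i pi < _) (left_config _ _ _) => RC P LC.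
by rewrite /c; clear -m0 i1 iN; lia.
Qed.
End Transition.

Lemma mem_ivl a b x : (x \in ivl a b) = (a < x <= b).
Proof. by rewrite mem_iota; lia. Qed.

Lemma sunion_ivl A B a b : (forall x, (x \in A) || (x \in B) = (a < x <= b)) ->
  sunion A B = ivl a b.
Proof. by move=> h; apply: sunion_iota => x; rewrite h; lia. Qed.

Lemma sminus_ivl a b B a' b' :
  (forall x, (a < x <= b) && (x \notin B) = (a' < x <= b')) ->
  sminus (ivl a b) B = ivl a' b'.
Proof.
move=> h; apply: sminus_iota; first exact: iota_ltn_sorted.
by move=> x; rewrite mem_ivl h; lia.
Qed.

Theorem theorem4p26 (la : seq nat) (T T' : seq (seq nat)) (i m j : nat) :
  is_SYT la T -> is_SYT la T' ->
  cs_edge la T i m T' ->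
  all (fun x => x \in blk (Des (sumn la) T) j) (iota i m.+1) ->
  let N := sumn la in
  let alpha := Des N T in
  let beta := Des N T' in
  let l := size alpha in
  let Iplus := iota (i + m).+1 m in
  let Iminus := iota i m in
  let mid := [:: i + m] in
  let result star :=
    [seq blk alpha k | k <- iota 1 (j - 2)]
      ++ [seq s <- star | size s != 0]
      ++ [seq blk alpha k | k <- iota j.+2 (l - j.+1)] in
  (* (1) rectangle-free on [i-1, i+2m] and on [i, i+2m+1] *)
  (~~ has_rectangle N T i.-1 (i + 2 * m) ->
   ~~ has_rectangle N T i (i + 2 * m).+1 ->
   size beta = l /\
   blocks beta = result [:: blk alpha j.-1;
                           sminus (blk alpha j) mid;
                           sunion (blk alpha j.+1) mid]) /\
  (* (2) rectangle on [i, i+2m+1] *)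
  (has_rectangle N T i (i + 2 * m).+1 ->
   size beta = l.+1 /\
   blocks beta = result [:: blk alpha j.-1;
                           sminus (blk alpha j) mid;
                           sunion Iplus mid;
                           sminus (blk alpha j.+1) Iplus]) /\
  (* (3) rectangle on [i-1, i+2m] *)
  (has_rectangle N T i.-1 (i + 2 * m) ->
   blk alpha j = sunion Iminus mid /\
   size beta = l.-1 /\
   blocks beta = result [:: sunion (blk alpha j.-1) Iminus;
                           sunion (blk alpha j.+1) mid]).
Proof.
move=> syt syt' edge inj N alpha beta l Iplus Iminus mid result.
have [RC [LC [[m0 i0 iN] [-> ->] [RN [LD [RD RL]]] inside mem']]] := transition syt syt' edge.
rewrite -/N in RN LD RD inside mem' iN.
set c := i + m in inside mem'.
have cds : c \in descents N T by rewrite inside ?eqxx // /c; clear -m0; lia.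
have sods := sorted_descents N T; have sods' := sorted_descents N T'.
have rgds d : d \in descents N T -> 0 < d < N.
  by rewrite (mem_descents d (is_SYT_standard syt)) => /andP[].
have BLa : blocks alpha = pairmap ivl 0 (rcons (descents N T) N) := blocks_Des N T.
have BLb : blocks beta = pairmap ivl 0 (rcons (descents N T') N) := blocks_Des N T'.
have sb : size beta = size (blocks beta) by exact: size_Des.
clearbody beta.
(* Cut the descents of [T] at [c]: as [c] is the only descent in [[i, i+2m-1]], those before it are
   below [i] and those after it at least [i + 2 * m]. *)
case/splitPr: cds sods rgds inside mem' LD RD BLa => X Y sods rgds inside mem' LD RD BLa.
move: (descents N T') sods' mem' BLb => ds' sods' mem' BLb.
have [sX scY XY] := (sorted_ltn_cat X (c :: Y)).1 sods.
have [_ sY cY'] := (sorted_ltn_cat [:: c] Y).1 scY.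
have cY v : v \in Y -> c < v by apply: cY'; rewrite mem_head.
have Xi x : x \in X -> x < i.
  move=> xX; have xc : x < c by apply: XY; rewrite // mem_head.
  rewrite ltnNge; apply/negP => ix.
  have := inside x; rewrite mem_cat xX /= => /(_ _) e.
  have /esym/eqP : true = (x == c) by apply: e; move: xc; rewrite /c; clear -ix; lia.
  by move=> e2; move: xc; rewrite e2 ltnn.
have Yi v : v \in Y -> i + 2 * m <= v.
  move=> vY; have cv := cY v vY; rewrite leqNgt; apply/negP => vi.
  have := inside v; rewrite mem_cat inE vY !orbT => e.
  have /esym/eqP : true = (v == c) by apply: e; move: cv; rewrite /c; clear -vi; lia.
  by move=> e2; move: cv; rewrite e2 ltnn.
(* Appending [N] guarantees an end [y] of the block after [c], even if [c] is the last descent. *)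
have eYZ : exists y Z, rcons Y N = y :: Z by case: (Y) => [|y Z]; [exists N, [::] | exists y, (rcons Z N)].
case: eYZ => y [Z eYZ].
have yi : i + 2 * m <= y.
  have : y \in rcons Y N by rewrite eYZ mem_head.
  by rewrite mem_rcons inE => /orP[/eqP->//|/Yi].
rewrite rcons_cat rcons_cons eYZ in BLa.
have soN : path ltn 0 (X ++ [:: c, y & Z]).
  rewrite -eYZ -rcons_cons -rcons_cat rcons_path (path_sortedE ltn_trans) sods andbT.
  apply/andP; split; first by apply/allP => d /rgds /andP[].
  have := mem_last 0 (X ++ c :: Y); move: (last _ _) => x; rewrite inE => /orP[/eqP->|/rgds/andP[]//].
  by clear -i0 iN; lia.
have ej : j = (size X).+1.
  have cj : c \in blk alpha j.
    by apply: (allP inj); rewrite mem_iota /c; clear; lia.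
  have j0 : 0 < j by case: (j) cj.
  rewrite blk_nth // BLa in cj.
  by rewrite -(block_index (path_sorted soN) cj) prednK.
pose a := last 0 X.
have ai : a < i.
  have := mem_last 0 X; rewrite -/a inE => /orP[/eqP->//|]; exact: Xi.
have bcur : blk alpha j = ivl a c := blk_cur BLa ej.
have bnext : blk alpha j.+1 = ivl c y := blk_next BLa ej.
have btail := blocks_tail BLa ej.
have sa : l = size X + (size Z).+2 := size_alpha BLa.
have eqds E : sorted ltn E -> (forall d, (d \in ds') = (d \in E)) -> ds' = E.
  by move=> sE h; apply: (irr_sorted_eq ltn_trans ltnn sods' sE).
have Xc x : x \in X -> x < c by move=> /Xi; rewrite /c; clear; lia.
have memds d : (d \in X ++ c :: Y) = [|| d \in X, d == c | d \in Y] by rewrite mem_cat inE.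
have XN x : x \in X -> (x == c) = false by move=> /Xc; clear; lia.
have YN x : x \in Y -> (x == c) = false by move=> /cY; clear; lia.
have scY' p : p <= c -> sorted ltn Y -> sorted ltn (p :: Y).
  move=> pc s; rewrite /= path_sortedE; last exact: ltn_trans.
  by rewrite s andbT; apply/allP => v /cY; clear -pc; lia.
have s1 : sminus (ivl a c) mid = ivl a c.-1.
  by apply: sminus_ivl => x; rewrite /mid inE -/c; move: ai; rewrite /c; clear -m0; lia.
have s2 : sunion (ivl c y) mid = ivl c.-1 y.
  apply: sunion_ivl => x; rewrite mem_ivl /mid inE -/c; move: yi; rewrite /c; clear -m0 i0; lia.
have n1 : (size (ivl a c.-1) != 0) by rewrite size_ivl /c; clear -ai m0; lia.
have n2 : (size (ivl c.-1 y) != 0) by rewrite size_ivl /c; clear -yi m0 i0; lia.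
split; [|split].
- move=> nL nR.
  (* With no rectangle the only change is that the descent [c] moves to [c.-1]. *)
  have ed : ds' = X ++ c.-1 :: Y.
    apply: eqds.
      apply/sorted_ltn_cat; split=> //; first by apply: scY'; rewrite ?leq_pred.
      move=> x v /Xi xi; rewrite inE => /orP[/eqP->|/cY]; rewrite /c; clear -xi m0; lia.
    move=> d; rewrite mem' (negbTE nL) (negbTE nR) !andbF andbT orFb memds mem_cat inE.
    case: (boolP (d \in X)) => [/XN->|_] /=; first by rewrite orbT.
    case: (boolP (d \in Y)) => [/YN->|_] /=; first by rewrite !orbT.
    by case: (d == c); rewrite ?orbF.
  rewrite ed rcons_cat rcons_cons eYZ pairmap_cat /= -/a in BLb.
  split.
    by rewrite sb BLb sa size_cat !size_pairmap /= size_pairmap.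
  rewrite BLb /result btail bcur bnext s1 s2 catA (blocks_head BLa soN ej) /= n1 n2 -catA.
  by [].
- move=> R; have rN := RN R; have rD := RD R; rewrite R /= in RL.
  (* The new descent [i + 2 * m] falls strictly inside the next block, since it is below [N] and was
     no descent before; so it splits that block into two non-empty parts. *)
  have ny : i + 2 * m < y.
    rewrite ltn_neqAle yi andbT; apply/eqP => ey.
    have : y \in rcons Y N by rewrite eYZ mem_head.
    rewrite mem_rcons inE => /orP[/eqP e|yY]; first by move: rN; rewrite ey e ltnn.
    by move: rD; rewrite memds ey yY !orbT.
  have nY v : v \in Y -> i + 2 * m < v.
    move=> vY; rewrite ltn_neqAle Yi // andbT; apply/eqP => e.
    by move: rD; rewrite memds e vY !orbT.
  have ed : ds' = X ++ [:: c.-1, i + 2 * m & Y].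
    apply: eqds.
      apply/sorted_ltn_cat; split=> //.
        apply/andP; split; first by rewrite /c; clear -m0; lia.
        change (path ltn (i + 2 * m) Y); rewrite path_sortedE; last exact: ltn_trans.
        by rewrite sY andbT; apply/allP => v /nY.
      move=> x v /Xi xi; rewrite !inE => /or3P[/eqP->|/eqP->|/cY]; rewrite /c; clear -xi m0; lia.
    move=> d; rewrite mem' R (negbTE RL) andbF !andbT memds mem_cat !inE.
    case: (boolP (d \in X)) => [/XN->|_] /=; first by rewrite !orbT.
    case: (boolP (d \in Y)) => [/YN->|_] /=; first by rewrite !orbT.
    by case: (d == c); rewrite ?orbF.
  rewrite ed rcons_cat !rcons_cons eYZ pairmap_cat /= -/a in BLb.
  have s3 : sunion Iplus mid = ivl c.-1 (i + 2 * m).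
    by apply: sunion_ivl => x; rewrite /Iplus mem_iota /mid inE /c; clear -m0; lia.
  have s4 : sminus (ivl c y) Iplus = ivl (i + 2 * m) y.
    by apply: sminus_ivl => x; rewrite /Iplus mem_iota /c; clear -ny; lia.
  have n3 : (size (ivl c.-1 (i + 2 * m)) != 0) by rewrite size_ivl /c; clear -m0; lia.
  have n4 : (size (ivl (i + 2 * m) y) != 0) by rewrite size_ivl.
  split.
    by rewrite sb BLb sa size_cat !size_pairmap /= size_pairmap; clear; lia.
  by rewrite BLb /result btail bcur bnext s1 s3 s4 catA (blocks_head BLa soN ej) /= n1 n3 n4 -catA.
- move=> L; have lD := LD L.
  have nR : ~~ RC by move: RL; rewrite L andbT.
  have i1 : i.-1 < i by rewrite prednK.
  (* [i.-1] is the last descent before [c], because all of [X] lies below [i]. It disappears, which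
     merges the remainder of block [j] into block [j-1] and makes block [j] of [T] start at [i]. *)
  have iX : i.-1 \in X.
    move: lD; rewrite memds => /or3P[//|/eqP e|/cY].
      by move: e; rewrite /c; clear -i0 m0; lia.
    by rewrite /c; clear -i0; lia.
  have [X' [x eX]] : exists X' x, X = rcons X' x.
    by case/lastP: (X) iX => // X' x _; exists X', x.
  subst X.
  have ex : x = i.-1.
    have xi : x < i by apply: Xi; rewrite mem_rcons mem_head.
    move: iX; rewrite mem_rcons inE => /orP[/eqP//|iX'].
    have : i.-1 < x.
      move: sX; rewrite -cats1 => /sorted_ltn_cat[_ _]; apply => //; exact: mem_head.
    by clear -xi; lia.
  have ea : a = i.-1 by rewrite /a last_rcons.
  have [bh bprev] := blocks_head2 BLa ej (erefl _).
  have X'x v : v \in X' -> v < x.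
    by move=> vX; move: sX; rewrite -cats1 => /sorted_ltn_cat[_ _]; apply => //; exact: mem_head.
  have sX' : sorted ltn X' by move: sX; rewrite -cats1 => /sorted_ltn_cat[].
  have lx : last 0 X' < x.
    by move: soN; rewrite cat_path rcons_path => /andP[/andP[]].
  have ed : ds' = X' ++ c.-1 :: Y.
    apply: eqds.
      apply/sorted_ltn_cat; split=> //; first by apply: scY'; rewrite ?leq_pred.
      move=> u v /X'x; rewrite ex inE => ui /orP[/eqP->|/cY]; rewrite /c; clear -ui m0; lia.
    move=> d; rewrite mem' L (negbTE nR) andbF andbT orFb memds mem_cat inE mem_rcons inE ex.
    have Y1 : d \in Y -> (d == i.-1) = false by move/cY; rewrite /c; clear; lia.
    have X1 : d \in X' -> (d == i.-1) = false by move/X'x; rewrite ex; clear; lia.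
    have X2 : d \in X' -> (d == c) = false.
      by move=> h; apply: XN; rewrite mem_rcons inE h orbT.
    case: (boolP (d \in X')) => [h|_] /=; first by rewrite (X1 h) (X2 h) !orbT.
    case: (boolP (d \in Y)) => [h|_] /=; first by rewrite (Y1 h) (YN _ h) !orbT.
    by case: (d == c); case: (d == i.-1); rewrite ?orbF.
  rewrite ed rcons_cat rcons_cons eYZ pairmap_cat /= in BLb.
  have s3 : sunion (ivl (last 0 X') x) Iminus = ivl (last 0 X') c.-1.
    apply: sunion_ivl => v; rewrite mem_ivl /Iminus mem_iota /c.
    by move: (last 0 X') lx => b; rewrite ex; clear -i0 m0; lia.
  have n3 : (size (ivl (last 0 X') c.-1) != 0).
    by rewrite size_ivl /c; move: (last 0 X') lx => b; rewrite ex; clear -i0 m0; lia.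
  split; last split.
  + rewrite bcur ea; apply/esym/sunion_ivl => v; rewrite /Iminus /mid mem_iota inE /c.
    by clear -i0; lia.
  + by rewrite sb BLb sa size_cat !size_pairmap /= size_pairmap size_rcons; clear; lia.
  + by rewrite BLb /result btail bh bprev bnext s2 s3 /= n3 n2.
Qed.
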